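(* For $r>0$ let $g_r$ be the $\mathrm{Sp}(2)$-invariant metric on $\mathbb{S}^7=\mathrm{Sp}(2)/\mathrm{Sp}(1)$ and, for $h\in\mathbb{S}^3$, let $\varphi_{(r,h)}$ be the $\mathrm{Sp}(2)$-invariant $\mathrm{G}_2$-structure described in the context. Then each $\mathbb{RP}^3$-family of $\mathrm{G}_2$-structures $$\mathcal{B}_r:=\Phi(\{r\}\times\mathrm{SO}(3))=\{\varphi_{(r,h)}: h\in\mathbb{S}^3\}\simeq\mathbb{RP}^3\simeq \mathbb{S}^3/\mathbb{Z}_2$$ equals the set of all $\mathrm{Sp}(2)$-invariant $\mathrm{G}_2$-structures (with the fixed orientation) inducing $g_r$, and determines a distinct isometric class. Moreover, in terms of the equator $\mathbb{RP}^2\simeq\{(h_0,h_1,0,h_3)\in\mathbb{S}^3\}/\mathbb{Z}_2$ and the poles $\mathrm{NS}=[(0,0,\pm1,0)]$, the following torsion regimes are characterised in each isometric class $\mathcal{B}_r$, up to the diffeomorphism $\Phi$ (identifying $\varphi_{(r,h)}$ with $(r,[h])$): (i) The coclosed $\mathrm{G}_2$-structures correspond to $\{r\}\times\mathbb{RP}^2$ and $\{r\}\times\mathrm{NS}$. (ii) The nearly parallel $\mathrm{G}_2$-structures correspond to $\{\sqrt[3]{2}\}\times\mathbb{RP}^2$ (round) and $\{\sqrt[3]{2/5}\}\times\mathrm{NS}$ (squashed). (iii) The locally conformal coclosed $\mathrm{G}_2$-structures correspond to $\{1\}\times\mathbb{RP}^3$. Furthermore, there is no purely coclosed structure in $\m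athcal{B}_r$.
   Context: $\mathfrak{sp}(2)=\{A\in\mathfrak{gl}(2,\mathbb{H}): A+A^*=0\}$, where $A^*=\bar A^T$. $\mathrm{Sp}(1)\subset\mathrm{Sp}(2)$ via $h\mapsto\mathrm{diag}(h,1)$; $\mathbb{S}^7=\mathrm{Sp}(2)/\mathrm{Sp}(1)$, with $o$ the class of the identity. The complement $\mathfrak{p}=\mathfrak{sp}(1)^\perp\simeq T_o\mathbb{S}^7$ (for $\langle A_1,A_2\rangle=\mathrm{Re}\,\mathrm{tr}(A_1A_2^* )$) has basis $e_1=\mathrm{diag}(0,i)$, $e_2=\mathrm{diag}(0,j)$, $e_3=\mathrm{diag}(0,k)$, $e_4=\frac1{\sqrt2}\begin{pmatrix}0&i\\ i&0\end{pmatrix}$, $e_5=\frac1{\sqrt2}\begin{pmatrix}0&j\\ j&0\end{pmatrix}$, $e_6=\frac1{\sqrt2}\begin{pmatrix}0&k\\ k&0\end{pmatrix}$, $e_7=\frac1{\sqrt2}\begin{pmatrix}0&1\\-1&0\end{pmatrix}$, dual basis $e^i$, $e^{ij\cdots}=e^i\wedge e^j\wedge\cdots$, and $\omega_1=e^{47}+e^{56}$, $\omega_2=e^{46}-e^{57}$, $\omega_3=e^{45}+e^{67}$. Invariant tensors on $\mathbb{S}^7$ are identified with $\mathrm{Ad}(\mathrm{Sp}(1))$-invariant tensors on $\mathfrak{p}$; for invariant $1$-forms $d\alpha(X,Y)=-\alpha([X,Y]_{\mathfrak p})$ on $\mathfrak{p}$, so e.g. $de^1=-2e^{23}-\omega_1$,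 $de^2=2e^{13}+\omega_2$, $de^3=-2e^{12}-\omega_3$. Orientation: $e^{1\cdots7}>0$. For $a>0$ and $D\in\mathrm{Gl}^+(3,\mathbb{R})$ (positive determinant): $\Phi(a,D)=a^3e^{123}+\sum_{i,l=1}^3(D^{-1})_{il}e^l\wedge\omega_i$. For a unit quaternion $h=(h_0,h_1,h_2,h_3)\in\mathbb{S}^3$, $$\Upsilon(h)=\begin{pmatrix}h_0^2+h_1^2-h_2^2-h_3^2&2(h_1h_2-h_0h_3)&2(h_1h_3+h_0h_2)\\2(h_1h_2+h_0h_3)&h_0^2-h_1^2+h_2^2-h_3^2&2(h_2h_3-h_0h_1)\\2(h_1h_3-h_0h_2)&2(h_2h_3+h_0h_1)&h_0^2-h_1^2-h_2^2+h_3^2\end{pmatrix}\in\mathrm{SO}(3).$$ Then $\varphi_{(r,h)}=\Phi(r,\Upsilon(\bar h))=r^3e^{123}+\sum_{i,l}\Upsilon(h)_{il}\,e^l\wedge\omega_i$, which depends only on $[h]=\{\pm h\}\in\mathbb{RP}^3$, and induces $g_r=r^2\sum_{i=1}^3(e^i)^2+\frac1r\sum_{i=4}^7(e^i)^2$. For a $\mathrm{G}_2$-structure $\varphi$ with dual $4$-form $\psi=*\varphi$, let $\tau_0=\frac17*(\varphi\wedge d\varphi)$ and $\tau_1=\frac1{12}*(\varphi\wedge *d\varphi)$. $\varphi$ is: coclosed if $d\psi=0$; nearly parallel if $d\varphi=\tau_0\psi$ (and so $d\psi=0$) with $\tau_0\neq0$ constant; locally conformal coclosed if $d\psi=4\tau_1\wedge\psi$;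 purely coclosed if $d\psi=0$ and $\tau_0=0$. Two $\mathrm{G}_2$-structures are isometric if they induce the same metric.
   Formalization: Item (iii) is proved as: locally conformal coclosed iff r = 1 or the structure is coclosed; as worded it fails, since coclosed structures with r ≠ 1 (e.g. r = 2, h = 1) have τ_1 = 0 and so satisfy dψ = 4τ_1∧ψ. *)

(* Defs.v *)
From HB Require Import structures.
From mathcomp Require Import all_boot all_order all_algebra.
From mathcomp Require Import ring.
From mathcomp Require Import boolp classical_sets reals.
From mathcomp Require Import topology normedtype derive exp.

Set Implicit Arguments.
Unset Strict Implicit.
Unset Printing Implicit Defensive.

Import Order.TTheory GRing.Theory Num.Theory.
Import numFieldNormedType.Exports.

Local Open Scope ring_scope.

(* The quaternion h0 + h1 i + h2 j + h3 k is the row (h0, h1, h2, h3). *)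
Definition quat (R : realType) : Type := 'rV[R]_4.

HB.instance Definition _ (R : realType) := GRing.Lmodule.copy (quat R) 'rV[R]_4.

Section Quaternions.
Variable R : realType.
Implicit Types p q : quat R.

Definition qmk (a b c d : R) : quat R :=
  \row_(n < 4) [:: a; b; c; d]`_n.

Definition q0 q : R := q ord0 (inord 0%N).
Definition q1 q : R := q ord0 (inord 1%N).
Definition q2 q : R := q ord0 (inord 2%N).
Definition q3 q : R := q ord0 (inord 3%N).

Definition qmul p q : quat R :=
  qmk (q0 p * q0 q - q1 p * q1 q - q2 p * q2 q - q3 p * q3 q)
      (q0 p * q1 q + q1 p * q0 q + q2 p * q3 q - q3 p * q2 q)
      (q0 p * q2 q - q1 p * q3 q + q2 p * q0 q + q3 p * q1 q)
      (q0 p * q3 q + q1 p * q2 q - q2 p * q1 q + q3 p * q0 q).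

Definition qone : quat R := qmk 1 0 0 0.
Definition qi : quat R := qmk 0 1 0 0.
Definition qj : quat R := qmk 0 0 1 0.
Definition qk : quat R := qmk 0 0 0 1.

Lemma qmkE a b c d : (q0 (qmk a b c d) = a) * (q1 (qmk a b c d) = b) *
  (q2 (qmk a b c d) = c) * (q3 (qmk a b c d) = d).
Proof. by rewrite /q0 /q1 /q2 /q3 !mxE !inordK. Qed.

Lemma quatP p q :
  q0 p = q0 q -> q1 p = q1 q -> q2 p = q2 q -> q3 p = q3 q -> p = q.
Proof.
rewrite /q0 /q1 /q2 /q3 => e0 e1 e2 e3; apply/rowP => n.
rewrite -(inord_val n); case: n => [[|[|[|[|n]]]] ltn] //=.
Qed.

Lemma qaddE p q : (q0 (p + q) = q0 p + q0 q) * (q1 (p + q) = q1 p + q1 q) *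
  (q2 (p + q) = q2 p + q2 q) * (q3 (p + q) = q3 p + q3 q).
Proof. by rewrite /q0 /q1 /q2 /q3 !mxE. Qed.

Fact qmulA : associative qmul.
Proof. by move=> x y z; apply: quatP; rewrite /qmul !qmkE; ring. Qed.

Fact qmul1q : left_id qone qmul.
Proof. by move=> x; apply: quatP; rewrite /qmul !qmkE; ring. Qed.

Fact qmulq1 : right_id qone qmul.
Proof. by move=> x; apply: quatP; rewrite /qmul !qmkE; ring. Qed.

Fact qmulDl : left_distributive qmul +%R.
Proof. by move=> x y z; apply: quatP; rewrite /qmul ?qaddE !qmkE ?qaddE; ring. Qed.

Fact qmulDr : right_distributive qmul +%R.
Proof. by move=> x y z; apply: quatP; rewrite /qmul ?qaddE !qmkE ?qaddE; ring. Qed.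

Fact qone_neq0 : qone != 0 :> quat R.
Proof.
by apply/eqP => /(congr1 q0); rewrite qmkE /q0 mxE => /eqP; rewrite oner_eq0.
Qed.

HB.instance Definition _ := GRing.Zmodule_isNzRing.Build (quat R)
  qmulA qmul1q qmulq1 qmulDl qmulDr qone_neq0.

Definition qconj q : quat R := qmk (q0 q) (- q1 q) (- q2 q) (- q3 q).

Definition S3 : set (quat R) :=
  [set h | q0 h ^+ 2 + q1 h ^+ 2 + q2 h ^+ 2 + q3 h ^+ 2 = 1]%classic.

End Quaternions.

Section HomogeneousSpace.
Variable R : realType.

Definition mx2 (a b c d : quat R) : 'M[quat R]_2 :=
  \matrix_(i < 2, j < 2) (nth [::] [:: [:: a; b]; [:: c; d]] i)`_j.

Definition hadj (A : 'M[quat R]_2) : 'M[quat R]_2 := (map_mx (@qconj R) A)^T.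

Definition sp2_inner (A B : 'M[quat R]_2) : R := q0 (\tr (A *m hadj B)).

Definition lie (A B : 'M[quat R]_2) : 'M[quat R]_2 := A *m B - B *m A.

(* An orthonormal basis, for [sp2_inner], of the orthogonal complement p of
   sp(1) in sp(2); the basis vector e_n is [pbasis (n-1)]. *)
Definition pbasis (n : 'I_7) : 'M[quat R]_2 :=
  let s := (Num.sqrt 2)^-1 : R in
  nth 0 [:: mx2 0 0 0 (qi R);
            mx2 0 0 0 (qj R);
            mx2 0 0 0 (qk R);
            mx2 0 (s *: qi R) (s *: qi R) 0;
            mx2 0 (s *: qj R) (s *: qj R) 0;
            mx2 0 (s *: qk R) (s *: qk R) 0;
            mx2 0 (s *: qone R) (- (s *: qone R)) 0] n.

(* A vector of p is the row of its coordinates in [pbasis]. *)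
Definition pvec (X : 'rV[R]_7) : 'M[quat R]_2 :=
  \sum_(n < 7) map_mx (fun q : quat R => X ord0 n *: q) (pbasis n).

(* Coordinates of the orthogonal projection to p. *)
Definition pproj (A : 'M[quat R]_2) : 'rV[R]_7 :=
  \row_(n < 7) sp2_inner A (pbasis n).

Definition lie_p (X Y : 'rV[R]_7) : 'rV[R]_7 := pproj (lie (pvec X) (pvec Y)).

Definition Sp1_in_Sp2 (h : quat R) : 'M[quat R]_2 := mx2 h 0 0 1.

(* The inverse of an element of Sp(2) is its adjoint. *)
Definition Ad (h : quat R) (X : 'rV[R]_7) : 'rV[R]_7 :=
  pproj (Sp1_in_Sp2 h *m pvec X *m hadj (Sp1_in_Sp2 h)).

End HomogeneousSpace.

(* The exterior algebra of p^*: a form is given by its coefficients on the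
   e^S = e^{s1} /\ ... /\ e^{sk}, for S = {s1 < ... < sk}. *)
Notation extform R := {ffun {set 'I_7} -> (R : realType)^o}.

Section ExteriorAlgebra.
Variable R : realType.
Implicit Types (a b : extform R) (X : 'rV[R]_7) (S T : {set 'I_7}).

(* e^S /\ e^T = sgn_shuffle S T * e^{S :|: T} for disjoint S and T *)
Definition sgn_shuffle S T : R :=
  (-1) ^+ #|[set u : 'I_7 * 'I_7 | [&& u.1 \in S, u.2 \in T & (u.2 < u.1)%N]]|.

Definition wedge a b : extform R :=
  [ffun S : {set 'I_7} => \sum_(T : {set 'I_7} | T \subset S)
               sgn_shuffle T (S :\: T) * a T * b (S :\: T)].

Definition fone : extform R := [ffun S : {set 'I_7} => (S == finset.set0)%:R].

Definition covec (n : 'I_7) : extform R :=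
  [ffun S : {set 'I_7} => (S == [set n])%:R].

(* [ee [:: i; j; ...]] is e^{ij...}, with indices from 1 to 7. *)
Definition ee (s : seq nat) : extform R :=
  foldr (fun k a => wedge (covec (inord k.-1)) a) fone s.

(* contraction in the first argument *)
Definition iota_ X a : extform R :=
  [ffun S : {set 'I_7} => \sum_(n < 7 | n \notin S)
               X ord0 n * sgn_shuffle [set n] S * a (n |: S)].

(* [feval a [:: X1; ...; Xk]] is a(X1, ..., Xk), for a of degree k. *)
Definition feval a (Xs : seq 'rV[R]_7) : R :=
  foldl (fun b X => iota_ X b) a Xs finset.set0.

(* pullback along the endomorphism X |-> X *m A *)
Definition pullback (A : 'M[R]_7) a : extform R :=
  [ffun S : {set 'I_7} => feval a [seq row n A | n <- enum S]].

Definition pvect (n : 'I_7) : 'rV[R]_7 := delta_mx ord0 n.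

(* de^n (X, Y) = - e^n ([X, Y]_p) *)
Definition dcovec (n : 'I_7) : extform R :=
  \sum_(i < 7) \sum_(j < 7 | (i < j)%N)
     (- lie_p (pvect i) (pvect j) ord0 n) *: wedge (covec i) (covec j).

(* The antiderivation extending [dcovec]; on Ad(Sp(1))-invariant forms it is
   the exterior derivative of invariant forms on Sp(2)/Sp(1). *)
Definition dext a : extform R :=
  \sum_(n < 7) wedge (dcovec n) (iota_ (pvect n) a).

Definition invariant a : Prop :=
  forall h : quat R, S3 h ->
  forall Xs : seq 'rV[R]_7, feval a [seq Ad h X | X <- Xs] = feval a Xs.

(* Hodge star of the metric with Gram matrix G, for e^{1...7} > 0:
   e^S /\ *a = <e^S, a> vol, where <e^S, a> is the value of a on the vectors
   metrically dual to e^{s1}, ..., e^{sk}, i.e. rows of the inverse of G. *)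
Definition hodge (G : 'M[R]_7) a : extform R :=
  [ffun T : {set 'I_7} => sgn_shuffle (~: T) T
             * feval a [seq row n (invmx G) | n <- enum (~: T)]
             * Num.sqrt (\det G)].

End ExteriorAlgebra.

Section G2Structures.
Variable R : realType.
Implicit Types f : extform R.

Definition omega (n : 'I_3) : extform R :=
  nth 0 [:: ee R [:: 4; 7]%N + ee R [:: 5; 6]%N;
            ee R [:: 4; 6]%N - ee R [:: 5; 7]%N;
            ee R [:: 4; 5]%N + ee R [:: 6; 7]%N] n.

Definition G2_model : extform R :=
  ee R [:: 1; 2; 3]%N + \sum_(n < 3) wedge (ee R [:: n.+1]%N) (omega n).

(* Pointwise oriented equivalence with the model on R^7. *)
Definition G2_structure f : Prop :=
  exists2 A : 'M[R]_7, 0 < \det A & f = pullback A G2_model.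

Definition invariant_G2 : set (extform R) :=
  [set f | G2_structure f /\ invariant f]%classic.

(* The coefficient on e^{1...7} of 1/6 (X _| f) /\ (Y _| f) /\ f *)
Definition hitchin_form f : 'M[R]_7 :=
  \matrix_(i < 7, j < 7)
    (6^-1 * wedge (wedge (iota_ (pvect R i) f) (iota_ (pvect R j) f)) f
              finset.setT).

(* The metric g with (X _| f) /\ (Y _| f) /\ f = 6 g(X, Y) vol_g: since
   [hitchin_form f] is g scaled by (det g)^(1/2), its determinant is
   (det g)^(9/2). *)
Definition metric f : 'M[R]_7 :=
  (\det (hitchin_form f)) `^ (- 9^-1) *: hitchin_form f.

Definition isometric f f' : Prop := metric f = metric f'.

Definition star f (a : extform R) : extform R := hodge (metric f) a.

Definition psi f : extform R := star f f.

Definition tau0 f : R := 7^-1 * star f (wedge f (dext f)) finset.set0.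

Definition tau1 f : extform R :=
  12^-1 *: star f (wedge f (star f (dext f))).

Definition coclosed f : Prop := dext (psi f) = 0.

Definition nearly_parallel f : Prop :=
  dext f = tau0 f *: psi f /\ tau0 f <> 0.

Definition loc_conf_coclosed f : Prop :=
  dext (psi f) = 4 *: wedge (tau1 f) (psi f).

Definition purely_coclosed f : Prop := coclosed f /\ tau0 f = 0.

End G2Structures.

Section Family.
Variable R : realType.

Local Open Scope classical_set_scope.

Definition Phi (a : R) (D : 'M[R]_3) : extform R :=
  a ^+ 3 *: ee R [:: 1; 2; 3]%N
  + \sum_(i < 3) \sum_(l < 3)
       invmx D i l *: wedge (ee R [:: l.+1]%N) (omega R i).

Definition Upsilon (h : quat R) : 'M[R]_3 :=
  let h0 := q0 h in let h1 := q1 h in let h2 := q2 h in let h3 := q3 h in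
  \matrix_(i < 3, j < 3)
    (nth [::]
      [:: [:: h0 ^+ 2 + h1 ^+ 2 - h2 ^+ 2 - h3 ^+ 2;
              2 * (h1 * h2 - h0 * h3);
              2 * (h1 * h3 + h0 * h2)];
          [:: 2 * (h1 * h2 + h0 * h3);
              h0 ^+ 2 - h1 ^+ 2 + h2 ^+ 2 - h3 ^+ 2;
              2 * (h2 * h3 - h0 * h1)];
          [:: 2 * (h1 * h3 - h0 * h2);
              2 * (h2 * h3 + h0 * h1);
              h0 ^+ 2 - h1 ^+ 2 - h2 ^+ 2 + h3 ^+ 2]] i)`_j.

Definition phi (r : R) (h : quat R) : extform R := Phi r (Upsilon (qconj h)).

Definition SO3 : set 'M[R]_3 := [set D | D *m D^T = 1%:M /\ \det D = 1].

Definition calB (r : R) : set (extform R) := [set Phi r D | D in SO3].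

Definition g_ (r : R) : 'M[R]_7 :=
  diag_mx (\row_(n < 7) if (n < 3)%N then r ^+ 2 else r^-1).

(* Preimages in S^3 of the equator RP^2 and of the poles NS of RP^3. *)
Definition equator : set (quat R) := [set h | S3 h /\ q2 h = 0].
Definition poles : set (quat R) := [set h | h = qj R \/ h = - qj R].

(* S^7 is the Sp(2)-orbit of v = (0, 1) in H^2, so X in p is identified with
   the tangent vector X v, the second column of X, whose lower entry is the
   component along the fibre v H of the Hopf fibration S^7 -> HP^1.  This is
   the metric of the unit sphere with the fibres rescaled by lam. *)
Definition hopf_metric (lam : R) : 'M[R]_7 :=
  \matrix_(m < 7, n < 7)
    (q0 (pbasis R m ord0 ord_max * qconj (pbasis R n ord0 ord_max))
     + lam * q0 (pbasis R m ord_max ord_max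
                 * qconj (pbasis R n ord_max ord_max))).

Definition homothetic (G G' : 'M[R]_7) : Prop :=
  exists2 c : R, 0 < c & G = c *: G'.

Definition round_metric (G : 'M[R]_7) : Prop := homothetic G (hopf_metric 1).

(* Up to scale, the second Sp(2)-invariant Einstein metric on S^7. *)
Definition squashed_metric (G : 'M[R]_7) : Prop :=
  homothetic G (hopf_metric 5^-1).

End Family.

Section ProjectiveSpace.
Variable R : realType.

Fixpoint Ck (n : nat) (u : 'rV[R]_4 -> R) : Prop :=
  if n is m.+1 then
    (forall x, differentiable u x) /\ (forall v, Ck m (fun x => 'D_v u x))
  else continuous u.

Definition smooth (F : 'rV[R]_4 -> extform R) : Prop :=
  forall S n, Ck n (fun x => F x S).

(* On S^3, f induces a smooth embedding of RP^3 = S^3 / {1, -1} into the space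
   of forms: an injective immersion whose inverse on the image is continuous.
   Smoothness and differentials are those of an extension F of f to R^4, the
   differential being restricted to the tangent spaces of S^3. *)
Definition RP3_embedding (f : quat R -> extform R) : Prop :=
  [/\ forall h k, S3 h -> S3 k -> (f h = f k <-> k = h \/ k = - h),
      exists F : 'rV[R]_4 -> extform R,
        [/\ smooth F,
            forall h, S3 h -> F h = f h &
            forall h v : 'rV[R]_4, @S3 R h ->
              \sum_(n < 4) h ord0 n * v ord0 n = 0 ->
              (forall S, 'D_v (fun x => F x S : R) h = 0) -> v = 0] &
      forall h, S3 h -> forall e : R, 0 < e -> exists2 d : R, 0 < d &
        forall k, S3 k -> (forall S, `|f k S - f h S| < d) ->
          `|(k - h : 'rV[R]_4)| < e \/ `|(k + h : 'rV[R]_4)| < e].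

End ProjectiveSpace.

(* Main.v *)
(* An invariant 3-form on p is a e^{123} + sum_il B_il e^l /\ omega_i.  Its
   Hitchin form is block diagonal, with blocks a B^T B and det B, so the metric
   is g_r exactly when a = r^3 and B is a rotation; unit quaternions give all
   rotations, two antipodal ones giving the same.  The torsion of phi_(r,h) is
   polynomial in r, 1/r and the entries of B = Upsilon h.  With
     a1 = B_23 + B_32 = 4 h2 h3, a2 = B_31 - B_13 = - 4 h0 h2,
     a3 = B_12 + B_21 = 4 h1 h2,  T = B_11 - B_22 + B_33 = 1 - 4 h2^2
   one finds d psi = 0 iff a1 = a2 = a3 = 0, i.e. h2 = 0 (and T = 1) or
   h = j, -j (and T = -3); tau_1 = (r^3 + 2) / 6 (- a1 e^1 + a2 e^2 + a3 e^3), so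
   that d psi - 4 tau_1 /\ psi is a multiple of r^3 - 1; and
   7 tau_0 = - 4 T (r^2 + 2 / r) - 12 / r, while the coefficient of
   e^{4567} in d phi = tau_0 psi reads tau_0 = - 2 T r^2, so that
   T (5 r^3 - 4) = 6. *)
Require Import Defs.
From mathcomp Require Import all_boot all_order all_algebra.
From mathcomp Require Import ring lra.
From mathcomp Require Import boolp classical_sets reals.
From mathcomp Require Import topology normedtype derive exp.
From mathcomp Require Import finset.

Set Implicit Arguments.
Unset Strict Implicit.
Unset Printing Implicit Defensive.

Import Order.TTheory GRing.Theory Num.Theory.
Local Open Scope ring_scope.

(** Why j is singled out: on the horizontal copy of H, with coordinates e^7 + e^4 i + e^5 j + e^6 k,
    the imaginary part of conj(y) z is (-omega_1, omega_2, -omega_3), and the omega_l enter de^1,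
    de^2, de^3 with the same signs. The sign matrix diag(-1, 1, -1) is Upsilon(j), so the quantities
    a1, a2, a3 and T are read off B Upsilon(j) = Upsilon(h j): T is minus its trace, that is 1 - 4
    Re(h j)^2, and the a's are, up to sign, its antisymmetric part. Two facts make the nonlinear
    algebra linear. The ten products h_a h_b are linear combinations of the nine entries of Upsilon
    h and of |h|^2; hence injectivity, immersion and continuity of the inverse on RP^3 all become
    statements about the matrix h h^T, within reach of [lra] with monomials as atoms. And a rotation
    equals its own cofactor matrix, which turns the quadratic terms in B of the torsion into linear
    ones. *)

(** * Exterior algebra on lists of monomials *)

Section SparseForms.
Variable R : realType.
Implicit Types (a b : extform R) (m : seq bool) (l : seq (R * seq bool)).
Implicit Types (S T : {set 'I_7}) (X : 'rV[R]_7).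

(* Forms are computed with as lists of pairs (coefficient, mask): the mask m
   stands for e^S with S = mset m.  Products, contractions, Hodge stars and
   differentials become structural recursions on these lists, which [lcbv]
   below evaluates, leaving one identity in R per coefficient. *)
Definition mset m : {set 'I_7} := [set i : 'I_7 | nth false m i]%SET.

Definition mono m : extform R := [ffun S : {set 'I_7} => (S == mset m)%:R].

Definition form_of l : extform R := \sum_(p <- l) p.1 *: mono p.2.

(** Plain recursions are used here instead of the generic [==] and sequence operations, so that
    [lcbv] can evaluate them by naming them, without unfolding anything else. *)
Fixpoint meq m m' : bool :=
  match m, m' with
  | [::], [::] => true
  | x :: s, y :: t => (if x then y else ~~ y) && meq s t
  | _, _ => false
  end.

Fixpoint mdisj m m' : bool :=
  match m, m' with
  | x :: s, y :: t => ~~ (x && y) && mdisj s t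
  | _, _ => true
  end.

Fixpoint mor m m' : seq bool :=
  match m, m' with
  | x :: s, y :: t => (x || y) :: mor s t
  | _, _ => [::]
  end.

Fixpoint mpar m : bool := if m is x :: s then addb x (mpar s) else false.

(* The parity of the number of pairs u in m, v in m' with v < u: the sign of
   e^m /\ e^m'. *)
Fixpoint minv m m' : bool :=
  match m, m' with
  | x :: s, y :: t => addb (y && mpar s) (minv s t)
  | _, _ => false
  end.

Fixpoint mdel (n : nat) m : seq bool :=
  match n, m with
  | 0, _ :: s => false :: s
  | n'.+1, x :: s => x :: mdel n' s
  | _, [::] => [::]
  end.

Fixpoint mnth (n : nat) m : bool :=
  match n, m with
  | 0, x :: s => x
  | n'.+1, x :: s => mnth n' s
  | _, [::] => false
  end.

Fixpoint mtake (n : nat) m : seq bool :=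
  match n, m with
  | n'.+1, x :: s => x :: mtake n' s
  | _, _ => [::]
  end.

Definition msgn (e : bool) (x : R) : R := if e then - x else x.

Fixpoint lmul1 (c : R) m l : seq (R * seq bool) :=
  if l is q :: l' then
    if mdisj m q.2 then
      (msgn (minv m q.2) (c * q.1), mor m q.2) :: lmul1 c m l'
    else lmul1 c m l'
  else [::].

Fixpoint lcat l l' := if l is p :: k then p :: lcat k l' else l'.

Fixpoint lwedge l l' : seq (R * seq bool) :=
  if l is p :: k then lcat (lmul1 p.1 p.2 l') (lwedge k l') else [::].

Fixpoint lscale (c : R) l : seq (R * seq bool) :=
  if l is p :: k then (c * p.1, p.2) :: lscale c k else [::].

Fixpoint liota (n : nat) l : seq (R * seq bool) :=
  if l is p :: k then
    if mnth n p.2 then (msgn (mpar (mtake n p.2)) p.1, mdel n p.2) :: liota n k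
    else liota n k
  else [::].

(** Products produce the same mask several times, and such entries are never merged; hence the
    sum. *)
Fixpoint coef m l : R :=
  if l is p :: k then if meq p.2 m then p.1 + coef m k else coef m k else 0.

Definition wf l := all (fun p : R * seq bool => size p.2 == 7%N) l.

Lemma meqP m m' : reflect (m = m') (meq m m').
Proof.
elim: m m' => [|x s IH] [|y t] /=; try by constructor.
apply: (iffP andP) => [[h /IH ->]|[-> <-]].
  by move: h; case: x; case: y.
by split; [case: (y)|apply/IH].
Qed.

Lemma in_mset m (i : 'I_7) : (i \in mset m) = nth false m i.
Proof. by rewrite inE. Qed.

Lemma mset_inj m m' : size m = 7%N -> size m' = 7%N -> mset m = mset m' -> m = m'.
Proof.
move=> s1 s2 /setP e; apply: (@eq_from_nth _ false); first by rewrite s1 s2.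
by move=> i; rewrite s1 => lti; have := e (Ordinal lti); rewrite !in_mset.
Qed.

Definition mask_of S : seq bool := [seq i \in S | i <- enum 'I_7].

Lemma size_mask_of S : size (mask_of S) = 7%N.
Proof. by rewrite size_map size_enum_ord. Qed.

Lemma mask_ofK S : mset (mask_of S) = S.
Proof.
apply/setP => i; rewrite in_mset (nth_map i) ?size_enum_ord //.
by rewrite nth_ord_enum.
Qed.

Lemma monoE m S : mono m S = (S == mset m)%:R.
Proof. by rewrite ffunE. Qed.

Lemma form_of_nil : form_of [::] = 0.
Proof. by rewrite /form_of big_nil. Qed.

Lemma form_of_cons p l : form_of (p :: l) = p.1 *: mono p.2 + form_of l.
Proof. by rewrite /form_of big_cons. Qed.

Lemma lcatE l l' : lcat l l' = l ++ l'.
Proof. by elim: l => //= p l ->. Qed.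

Lemma form_of_cat l l' : form_of (l ++ l') = form_of l + form_of l'.
Proof. by rewrite /form_of big_cat. Qed.

Lemma form_of_scale c l : form_of (lscale c l) = c *: form_of l.
Proof.
elim: l => [|p l IH]; first by rewrite /= form_of_nil scaler0.
by rewrite /= !form_of_cons IH scalerDr scalerA.
Qed.

Lemma form_of_coef l m : wf l -> size m = 7%N -> form_of l (mset m) = coef m l.
Proof.
move=> wl sm; elim: l wl => [|p l IH] /=; first by rewrite form_of_nil ffunE.
case/andP=> /eqP sp wl; rewrite form_of_cons ffunE IH // ffunE monoE.
case: meqP => [->|ne]; first by rewrite eqxx /= [_ *: _]mulr1.
rewrite (_ : _ == _ = false) ?[_ *: _]mulr0 ?add0r //.
by apply/eqP => e; apply: ne; apply: esym; apply: mset_inj.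
Qed.

Lemma form_eq a b : (forall m, size m = 7%N -> a (mset m) = b (mset m)) -> a = b.
Proof.
by move=> h; apply/ffunP => S; rewrite -(mask_ofK S); apply: h; rewrite size_mask_of.
Qed.

Definition lnorm (ks : seq (seq bool)) l : seq (R * seq bool) :=
  [seq (coef k l, k) | k <- ks].

Fixpoint mmem m (ks : seq (seq bool)) : bool :=
  if ks is k :: s then meq k m || mmem m s else false.

Fixpoint muniq (ks : seq (seq bool)) : bool :=
  if ks is k :: s then ~~ mmem k s && muniq s else true.

(** Keys absent from [l] are allowed and receive coefficient 0, so that one key list can serve both
    sides of an identity. *)
Definition covers (ks : seq (seq bool)) l :=
  [&& wf l, all (fun k => size k == 7%N) ks, muniq ks
    & all (fun p : R * seq bool => mmem p.2 ks) l].

Lemma coef_lnorm ks l m : muniq ks ->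
  coef m (lnorm ks l) = if mmem m ks then coef m l else 0.
Proof.
elim: ks => [|k ks IH] //= /andP[nk uk].
case: meqP => [ek|_] /=; last by rewrite IH.
by rewrite IH // -ek (negbTE nk) addr0.
Qed.

Lemma form_of_lnorm ks l : covers ks l -> form_of l = form_of (lnorm ks l).
Proof.
case/and4P=> wl wk uk ck; apply: form_eq => m sm.
have wn : wf (lnorm ks l) by rewrite /wf all_map; exact: wk.
rewrite !form_of_coef // coef_lnorm //; case: ifPn => // nm.
elim: l wl ck {wn} => [|p l IH] //= /andP[_ wl] /andP[pk ck].
by case: meqP => [pm|_]; [move: nm; rewrite -pm pk|rewrite IH].
Qed.

(** Induction on both masks: index 0 of [m] starts no inversion, nothing being smaller, while index
    0 of [m'] is inverted with every later element of [m], a number whose parity is [mpar]. *)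
Lemma odd_minv n m m' : size m = n -> size m' = n ->
  odd (\sum_(i < n) \sum_(j < n)
        [&& nth false m i, nth false m' j & (j < i)%N]) = minv m m'.
Proof.
have oddpar k s : size s = k -> odd (\sum_(i < k) nth false s i) = mpar s.
  elim: k s => [|k IH] [|x s] //=; first by rewrite big_ord0.
  by move=> [sk]; rewrite big_ord_recl /= oddD (IH s sk); case: x.
elim: n m m' => [|n IH] [|x s] [|y t] //=; first by rewrite big_ord0.
move=> [sm] [sm'].
rewrite big_ord_recl big1 => [|j _]; last by rewrite ltn0 !andbF.
rewrite add0n /=.
under eq_bigr do rewrite big_ord_recl /=.
rewrite big_split /= oddD; congr (_ (+) _); last exact: IH.
rewrite -(oddpar _ _ sm); case: y => /=; last first.
  by rewrite big1 // => i _; rewrite andbF.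
by congr (odd _); apply: eq_bigr => i _; rewrite andbT.
Qed.

Lemma sgn_shuffleE m m' : size m = 7%N -> size m' = 7%N ->
  sgn_shuffle R (mset m) (mset m') = msgn (minv m m') 1.
Proof.
move=> sm sm'; rewrite /sgn_shuffle -signr_odd.
rewrite -sum1_card big_mkcond /= -(@odd_minv 7 m m') //.
rewrite pair_bigA /=.
rewrite (eq_bigr (fun p : 'I_7 * 'I_7 => [&& nth false m p.1, nth false m' p.2 & (p.2 < p.1)%N] : nat)).
  by rewrite /msgn; case: (odd _); rewrite ?expr1 ?expr0.
by move=> p _; rewrite !inE; case: [&& _, _ & _].
Qed.

Lemma msgnE (e : bool) (x : R) : msgn e x = (-1) ^+ e * x.
Proof. by case: e; rewrite /= ?mulN1r ?mul1r. Qed.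

Lemma mdisjP m m' : size m = 7%N -> size m' = 7%N ->
  mdisj m m' = [disjoint mset m & mset m'].
Proof.
have gen n s t : size s = n -> size t = n ->
    reflect (forall i, ~~ (nth false s i && nth false t i)) (mdisj s t).
  elim: n s t => [|n IH] [|x s] [|y t] //=.
    by move=> _ _; constructor => i; rewrite !nth_nil.
  move=> [ss] [st]; apply: (iffP andP) => [[h /(IH _ _ ss st) h'] [|i]|h] //=.
  by split; [apply: (h 0%N)|apply/(IH _ _ ss st) => i; apply: (h i.+1)].
move=> sm sm'; apply/(gen 7%N)/idP => // [h|h i].
  by rewrite -setI_eq0; apply/eqP/setP => i; rewrite !inE; apply/negbTE.
case: (ltnP i 7) => lti; last by rewrite [nth _ m i]nth_default ?sm.
apply/negP => /andP[hm hm'].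
have /(disjointFr h) : Ordinal lti \in mset m by rewrite in_mset.
by rewrite in_mset /= hm'.
Qed.

Lemma size_mor m m' : size (mor m m') = minn (size m) (size m').
Proof. by elim: m m' => [|x s IH] [|y t] //=; rewrite IH minnSS. Qed.

Lemma morE m m' : size m = 7%N -> size m' = 7%N ->
  mset (mor m m') = (mset m :|: mset m')%SET.
Proof.
have gen n s t i : size s = n -> size t = n ->
    nth false (mor s t) i = nth false s i || nth false t i.
  elim: n s t i => [|n IH] [|x s] [|y t] //=.
    by move=> i; rewrite !nth_nil.
  by move=> [|i] [ss] [st] //=; rewrite IH.
by move=> sm sm'; apply/setP => i; rewrite !inE (gen 7%N).
Qed.

Lemma wedgeDl a a' b : wedge (a + a') b = wedge a b + wedge a' b.
Proof.
apply/ffunP => S; rewrite !ffunE -big_split; apply: eq_bigr => T _ /=.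
by rewrite ffunE mulrDr mulrDl.
Qed.

Lemma wedgeDr a b b' : wedge a (b + b') = wedge a b + wedge a b'.
Proof.
apply/ffunP => S; rewrite !ffunE -big_split; apply: eq_bigr => T _ /=.
by rewrite ffunE mulrDr.
Qed.

Lemma wedgeZl c a b : wedge (c *: a) b = c *: wedge a b.
Proof.
apply/ffunP => S; rewrite !ffunE [RHS]mulr_sumr; apply: eq_bigr => T _ /=.
by rewrite ffunE [X in X * _]mulrCA -[LHS]mulrA.
Qed.

Lemma wedgeZr c a b : wedge a (c *: b) = c *: wedge a b.
Proof.
apply/ffunP => S; rewrite !ffunE [RHS]mulr_sumr; apply: eq_bigr => T _ /=.
by rewrite ffunE mulrCA.
Qed.

Lemma wedge0l b : wedge 0 b = 0.
Proof. by have := wedgeZl 0 0 b; rewrite !scale0r. Qed.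

Lemma wedge0r b : wedge b 0 = 0.
Proof. by have := wedgeZr 0 b 0; rewrite !scale0r. Qed.

(** In the sum over T inside S only T = [mset m] contributes, and then S minus T has to be
    [mset m']; this is possible only for disjoint masks. *)
Lemma wedge_mono m m' : size m = 7%N -> size m' = 7%N ->
  wedge (mono m) (mono m') =
    if mdisj m m' then msgn (minv m m') 1 *: mono (mor m m') else 0.
Proof.
move=> sm sm'; rewrite mdisjP //; apply/ffunP => S; rewrite ffunE.
have [sub|nsub] := boolP (mset m \subset S); last first.
  rewrite big1 => [|T TS].
    case: ifP => _; rewrite ?ffunE // morE //.
    case: eqP => [e|_]; last by rewrite [_ *: _]mulr0.
    by rewrite e subsetUl in nsub.
  by rewrite monoE; case: eqP => [e|_]; [rewrite -e TS in nsub|rewrite mulr0 mul0r].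
rewrite (bigD1 (mset m)) //= big1 ?addr0 => [|T /andP[_ /negbTE nT]]; last first.
  by rewrite monoE nT mulr0 mul0r.
rewrite !monoE eqxx mulr1.
case: ifPn => dis; last first.
  rewrite ffunE; case: eqP => [e|_]; last by rewrite mulr0.
  by move: dis; rewrite -e disjoint_sym -setI_eq0 setIDAC setDIl setDv setI0 eqxx.
rewrite ffunE monoE morE //; have -> : (S :\: mset m == mset m')%SET = (S == mset m :|: mset m')%SET.
  apply/eqP/eqP => [<-|->]; first by rewrite -{1}(setID S (mset m)) (setIidPr sub).
  by rewrite setDUl setDv set0U; apply/setDidPl; rewrite disjoint_sym.
case: eqP => [e|_]; last by rewrite mulr0 [_ *: _]mulr0.
rewrite -sgn_shuffleE // mulr1 [_ *: _]mulr1; congr sgn_shuffle.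
by rewrite e setDUl setDv set0U; apply/setDidPl; rewrite disjoint_sym.
Qed.

Lemma size_mdel n m : size (mdel n m) = size m.
Proof. by elim: m n => [|x s IH] [|n] //=; rewrite IH. Qed.

Lemma mnthE n m : mnth n m = nth false m n.
Proof. by elim: m n => [|x s IH] [|n] //=. Qed.

Lemma mdelE (n : 'I_7) m : mset (mdel n m) = mset m :\ n.
Proof.
have gen s k i : nth false (mdel k s) i = (i != k) && nth false s i.
  elim: s k i => [|x s IH] [|k] [|i] //=; rewrite ?nth_nil ?andbF //.
  by rewrite IH eqSS.
by apply/setP => i; rewrite !inE gen.
Qed.

Lemma set1_mset (n : 'I_7) : [set n] = mset (mkseq (fun i => i == n :> nat) 7).
Proof. by apply/setP => i; rewrite !inE nth_mkseq. Qed.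

Lemma sgn_shuffle1 (n : 'I_7) m : size m = 7%N ->
  sgn_shuffle R [set n] (mset m) = msgn (mpar (mtake n m)) 1.
Proof.
move=> sm; rewrite set1_mset sgn_shuffleE ?size_mkseq //; congr msgn.
case: m sm => [|b0 [|b1 [|b2 [|b3 [|b4 [|b5 [|b6 []]]]]]]] // _.
by case: n => [[|[|[|[|[|[|[|n]]]]]]] lt_n] //=; rewrite ?andbF ?andbT ?addbF ?addFb.
Qed.

Lemma form_of_lcat l l' : form_of (lcat l l') = form_of l + form_of l'.
Proof. by rewrite lcatE form_of_cat. Qed.

Lemma form_of_lmul1 c m l : size m = 7%N -> wf l ->
  form_of (lmul1 c m l) = wedge (c *: mono m) (form_of l).
Proof.
move=> sm; elim: l => [|q l IH] /=; first by rewrite form_of_nil wedge0r.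
case/andP=> /eqP sq wl; rewrite form_of_cons wedgeDr -IH //.
rewrite wedgeZl wedgeZr wedge_mono //; case: ifP => _; last by rewrite !scaler0 add0r.
by rewrite form_of_cons /= !scalerA !msgnE mulr1 mulrC.
Qed.

Lemma form_of_wedge l l' : wf l -> wf l' ->
  form_of (lwedge l l') = wedge (form_of l) (form_of l').
Proof.
move=> wl wl'; elim: l wl => [|p l IH] /=; first by rewrite form_of_nil wedge0l.
case/andP=> /eqP sp wl; rewrite form_of_lcat form_of_lmul1 // IH //.
by rewrite form_of_cons wedgeDl.
Qed.

Lemma iota_Dr X a b : iota_ X (a + b) = iota_ X a + iota_ X b.
Proof.
apply/ffunP => S; rewrite !ffunE -big_split; apply: eq_bigr => n _ /=.
by rewrite ffunE mulrDr.
Qed.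

Lemma iota_Zr X c a : iota_ X (c *: a) = c *: iota_ X a.
Proof.
apply/ffunP => S; rewrite !ffunE [RHS]mulr_sumr; apply: eq_bigr => n _ /=.
by rewrite ffunE mulrCA.
Qed.

Lemma iota_0r X : iota_ X 0 = 0.
Proof. by have := iota_Zr X 0 0; rewrite !scale0r. Qed.

Lemma iota_pvect (n : 'I_7) a S :
  iota_ (pvect R n) a S =
    if n \in S then 0 else sgn_shuffle R [set n] S * a (n |: S).
Proof.
rewrite ffunE; case: ifPn => nS.
  rewrite big1 // => k kS; rewrite mxE eqxx /=.
  by case: eqP => [e|_]; rewrite ?mul0r //; rewrite e nS in kS.
rewrite (bigD1 n) //= big1 => [|k /andP[_ /negbTE kn]].
  by rewrite mxE !eqxx mul1r addr0.
by rewrite mxE kn !mul0r.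
Qed.

Lemma iota_basis X a : iota_ X a = \sum_(n < 7) X ord0 n *: iota_ (pvect R n) a.
Proof.
apply/ffunP => S; rewrite ffunE sum_ffunE big_mkcond; apply: eq_bigr => n _.
rewrite [in RHS]ffunE iota_pvect; case: (n \in S) => /=; first by rewrite scaler0.
by rewrite -mulrA.
Qed.

Lemma iota_mono (n : 'I_7) m : size m = 7%N ->
  iota_ (pvect R n) (mono m) =
    if mnth n m then msgn (mpar (mtake n m)) 1 *: mono (mdel n m) else 0.
Proof.
move=> sm; apply: form_eq => s ss; rewrite iota_pvect sgn_shuffle1 // monoE.
have memn : mnth n m = (n \in mset m) by rewrite in_mset mnthE.
(* The sign counts only indices below n, which deleting n leaves in place. *)
have takedel : mpar (mtake n (mdel n m)) = mpar (mtake n m).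
  by move: (n : nat) => k; elim: m k {sm memn} => [|x t IH] [|k] //=; rewrite IH.
case: ifPn => ns.
  rewrite memn; case: ifP => // _; last by rewrite ffunE.
  rewrite ffunE monoE mdelE; case: eqP => [e|_]; last by rewrite [_ *: _]mulr0.
  by rewrite e !inE eqxx in ns.
have -> : (n |: mset s == mset m) = (n \in mset m) && (mset s == mset (mdel n m)).
  rewrite mdelE; apply/eqP/andP => [<-|[nm /eqP->]]; last by rewrite setD1K.
  by rewrite setU11 setU1K.
rewrite memn; case: (n \in mset m) => /=; last by rewrite ffunE mulr0.
rewrite ffunE monoE; case: eqP => [|_]; last by rewrite mulr0 [_ *: _]mulr0.
by move=> /mset_inj -> //; rewrite ?size_mdel // takedel.
Qed.

Lemma form_of_iota (n : 'I_7) l : wf l ->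
  form_of (liota n l) = iota_ (pvect R n) (form_of l).
Proof.
elim: l => [|p l IH] /=; first by rewrite form_of_nil iota_0r.
case/andP=> /eqP sp wl; rewrite form_of_cons iota_Dr iota_Zr iota_mono //.
case: ifP => _; last by rewrite scaler0 add0r IH.
by rewrite form_of_cons /= IH // scalerA !msgnE mulr1 mulrC.
Qed.

Lemma wf_lcat l l' : wf (lcat l l') = wf l && wf l'.
Proof. by rewrite lcatE /wf all_cat. Qed.

Lemma wf_lscale c l : wf (lscale c l) = wf l.
Proof. by elim: l => //= p l ->. Qed.

Lemma wf_liota n l : wf l -> wf (liota n l).
Proof.
elim: l => //= p l IH /andP[sp wl]; by case: ifP => _ /=; rewrite ?size_mdel ?sp IH.
Qed.

Lemma wf_lwedge l l' : wf l -> wf l' -> wf (lwedge l l').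
Proof.
move=> wl wl'; elim: l wl => //= p l IH /andP[/eqP sp wl]; rewrite wf_lcat IH // andbT.
elim: l' wl' {IH} => //= q l' IH /andP[/eqP sq wl'].
by case: ifP => _ /=; rewrite IH // size_mor sp sq.
Qed.

(** Contraction with a general vector, unrolled; its coordinates are a function on [nat], so that no
    [inord] blocks the evaluation. *)
Definition lioX (x : nat -> R) l : seq (R * seq bool) :=
  lcat (lscale (x 0%N) (liota 0 l)) (lcat (lscale (x 1%N) (liota 1 l))
  (lcat (lscale (x 2%N) (liota 2 l)) (lcat (lscale (x 3%N) (liota 3 l))
  (lcat (lscale (x 4%N) (liota 4 l)) (lcat (lscale (x 5%N) (liota 5 l))
   (lscale (x 6%N) (liota 6 l))))))).

Lemma wf_lioX x l : wf l -> wf (lioX x l).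
Proof. by move=> wl; rewrite /lioX !wf_lcat !wf_lscale !wf_liota. Qed.

Lemma form_of_iotaX X l : wf l ->
  form_of (lioX (fun n => X ord0 (inord n)) l) = iota_ X (form_of l).
Proof.
move=> wl; rewrite iota_basis.
transitivity (\sum_(0 <= n < 7) X ord0 (inord n) *: form_of (liota n l)).
  rewrite /lioX !form_of_lcat !form_of_scale /index_iota /=.
  by rewrite !big_cons big_nil addr0.
by rewrite big_mkord; apply: eq_bigr => n _; rewrite inord_val form_of_iota.
Qed.

Lemma feval3_form_of X Y Z l : wf l ->
  feval (form_of l) [:: X; Y; Z] =
    coef (nseq 7 false) (lioX (fun n => Z ord0 (inord n))
      (lioX (fun n => Y ord0 (inord n)) (lioX (fun n => X ord0 (inord n)) l))).
Proof.
move=> wl; rewrite /feval /= -!form_of_iotaX //; last by rewrite wf_lioX.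
  rewrite (_ : set0 = mset (nseq 7 false)).
    by rewrite form_of_coef // !wf_lioX.
  by apply/setP => i; rewrite !inE nth_nseq if_same.
by rewrite !wf_lioX.
Qed.

(** The last vector is contracted outermost, so the indices join [T] from the largest down; each
    lies below everything already present and every shuffle sign is +1. *)
Lemma foldl_iota_pairwise (d : 'I_7 -> R) a (s : seq 'I_7) T :
  pairwise (fun i j : 'I_7 => (i < j)%N) s ->
  (forall i j : 'I_7, i \in s -> j \in T -> (i < j)%N) ->
  foldl (fun b X => iota_ X b) a [seq d n *: pvect R n | n <- s] T =
    \prod_(n <- s) d n * a ([set n in s] :|: T).
Proof.
elim/last_ind: s T => [|s x IH] T.
  move=> _ _; rewrite big_nil mul1r /=; congr (a _).
  by apply/setP => i; rewrite !inE.
rewrite pairwise_rcons; case/andP=> /allP sx ss sT; rewrite map_rcons foldl_rcons.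
have -> b : iota_ (d x *: pvect R x) b = d x *: iota_ (pvect R x) b.
  apply/ffunP => S; rewrite !ffunE [RHS]mulr_sumr; apply: eq_bigr => k _.
  by rewrite mxE /= !mulrA.
rewrite ffunE iota_pvect.
have xT : x \notin T.
  by apply/negP => xT; have := sT x x; rewrite ltnn mem_rcons mem_head => /(_ isT xT).
rewrite (negbTE xT) IH //; first last.
  move=> i j si; rewrite !inE => /orP[/eqP->|jT]; first exact: sx.
  by apply: sT => //; rewrite mem_rcons inE si orbT.
have -> : sgn_shuffle R [set x] T = 1.
  rewrite /sgn_shuffle (_ : [set _ | _] = set0) ?cards0 ?expr0 //.
  apply/setP => -[u v]; rewrite !inE /=; apply/negP => /and3P[/eqP-> vT].
  by rewrite ltnNge (ltnW (sT _ _ _ vT)) // mem_rcons mem_head.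
rewrite mul1r big_rcons /= -[LHS]/(d x * (_ * a _)) mulrA [d x * _]mulrC; congr (_ * a _).
by apply/setP => i; rewrite !inE mem_rcons inE orbCA orbA.
Qed.
End SparseForms.

(** * The bracket and the adjoint action in quaternionic coordinates *)

Section QuaternionComputations.
Variable R : realType.
Implicit Types (p q : quat R) (X Y : 'rV[R]_7).

Lemma qmulE p q :
  (q0 (p * q) = q0 p * q0 q - q1 p * q1 q - q2 p * q2 q - q3 p * q3 q) *
  (q1 (p * q) = q0 p * q1 q + q1 p * q0 q + q2 p * q3 q - q3 p * q2 q) *
  (q2 (p * q) = q0 p * q2 q - q1 p * q3 q + q2 p * q0 q + q3 p * q1 q) *
  (q3 (p * q) = q0 p * q3 q + q1 p * q2 q - q2 p * q1 q + q3 p * q0 q).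
Proof. by rewrite [p * q]/(qmul p q) /qmul !qmkE. Qed.

Lemma qscaleE (c : R) q : (q0 (c *: q) = c * q0 q) * (q1 (c *: q) = c * q1 q) *
  (q2 (c *: q) = c * q2 q) * (q3 (c *: q) = c * q3 q).
Proof. by rewrite /q0 /q1 /q2 /q3 !mxE. Qed.

Lemma qoppE q : (q0 (- q) = - q0 q) * (q1 (- q) = - q1 q) *
  (q2 (- q) = - q2 q) * (q3 (- q) = - q3 q).
Proof. by rewrite /q0 /q1 /q2 /q3 !mxE. Qed.

Lemma qconjE q : (q0 (qconj q) = q0 q) * (q1 (qconj q) = - q1 q) *
  (q2 (qconj q) = - q2 q) * (q3 (qconj q) = - q3 q).
Proof. by rewrite /qconj !qmkE. Qed.

Lemma qzeroE : (q0 (0 : quat R) = 0) * (q1 (0 : quat R) = 0) *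
  (q2 (0 : quat R) = 0) * (q3 (0 : quat R) = 0).
Proof. by rewrite /q0 /q1 /q2 /q3 !mxE. Qed.

Lemma qoneE : (q0 (1 : quat R) = 1) * (q1 (1 : quat R) = 0) *
  (q2 (1 : quat R) = 0) * (q3 (1 : quat R) = 0).
Proof. by rewrite [1]/(qone R) /qone !qmkE. Qed.

Definition qE := (qmulE, qscaleE, qoppE, qconjE, qzeroE, qoneE, @qaddE R, @qmkE R).

Lemma mx2E (a b c d : quat R) (A : 'M[quat R]_2) :
  A ord0 ord0 = a -> A ord0 ord_max = b -> A ord_max ord0 = c -> A ord_max ord_max = d ->
  A = mx2 a b c d.
Proof.
move=> ea eb ec ed; apply/matrixP => i j; rewrite mxE.
have ord2 (k : 'I_2) : k = ord0 \/ k = ord_max.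
  by case: k => [[|[|k]]] ltk //; [left|right]; apply: val_inj.
by case: (ord2 i) => ->; case: (ord2 j) => -> /=.
Qed.

Lemma mx2_entries (a b c d : quat R) :
  (mx2 a b c d ord0 ord0 = a) * (mx2 a b c d ord0 ord_max = b) *
  (mx2 a b c d ord_max ord0 = c) * (mx2 a b c d ord_max ord_max = d).
Proof. by rewrite !mxE. Qed.

Lemma sum_ord2 (V : nmodType) (F : 'I_2 -> V) : \sum_(i < 2) F i = F ord0 + F ord_max.
Proof.
by rewrite !big_ord_recl big_ord0 addr0; congr (_ + F _); apply: val_inj.
Qed.

Lemma mx2_mul (a b c d a' b' c' d' : quat R) :
  mx2 a b c d *m mx2 a' b' c' d' =
    mx2 (a * a' + b * c') (a * b' + b * d') (c * a' + d * c') (c * b' + d * d').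
Proof. by apply: mx2E; rewrite mxE sum_ord2 !mx2_entries. Qed.

Lemma hadj_mx2 (a b c d : quat R) :
  hadj (mx2 a b c d) = mx2 (qconj a) (qconj c) (qconj b) (qconj d).
Proof. by apply: mx2E; rewrite !mxE. Qed.

Lemma mx2_sub (a b c d a' b' c' d' : quat R) :
  mx2 a b c d - mx2 a' b' c' d' = mx2 (a - a') (b - b') (c - c') (d - d').
Proof. by apply: mx2E; rewrite !mxE. Qed.

Lemma mxtrace_mx2 (a b c d : quat R) : \tr (mx2 a b c d) = a + d.
Proof. by rewrite /mxtrace sum_ord2 !mx2_entries. Qed.

Definition rsqrt2 : R := (Num.sqrt 2)^-1.

Lemma rsqrt2_sqr : rsqrt2 * rsqrt2 = 2^-1.
Proof. by rewrite /rsqrt2 -invfM -expr2 sqr_sqrtr. Qed.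

(** With [horiz], the splitting of p into Im H (tangent to the Hopf fibre) and H; the real part of
    the latter is the coordinate of e_7, hence index 6 in front. *)
Definition vert X : quat R :=
  qmk 0 (X ord0 (inord 0)) (X ord0 (inord 1)) (X ord0 (inord 2)).

Definition horiz X : quat R :=
  qmk (X ord0 (inord 6)) (X ord0 (inord 3)) (X ord0 (inord 4)) (X ord0 (inord 5)).

Lemma sum_ord7 (V : nmodType) (F : 'I_7 -> V) :
  \sum_(i < 7) F i = F (inord 0) + (F (inord 1) + (F (inord 2) + (F (inord 3)
    + (F (inord 4) + (F (inord 5) + F (inord 6)))))).
Proof.
transitivity (\sum_(0 <= n < 7) F (inord n)).
  by rewrite big_mkord; apply: eq_bigr => i _; rewrite inord_val.
by rewrite /index_iota /= !big_cons big_nil addr0.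
Qed.

Lemma pvecE X :
  pvec X = mx2 0 (rsqrt2 *: horiz X) (- (rsqrt2 *: qconj (horiz X))) (vert X).
Proof.
apply: mx2E; rewrite /pvec sum_ord7 !mxE /pbasis !inordK //= !mx2_entries;
  by apply: quatP; rewrite /vert /horiz /qi /qj /qk /qone -/rsqrt2 !qE; ring.
Qed.

Definition pcoord (b d : quat R) : 'rV[R]_7 :=
  \row_(n < 7) [:: q1 d; q2 d; q3 d; q1 b; q2 b; q3 b; q0 b]`_n.

(** The entry [a] disappears because every basis vector of p has upper left entry 0. *)
Lemma pproj_skew (a b d : quat R) :
  pproj (mx2 a (rsqrt2 *: b) (- (rsqrt2 *: qconj b)) d) = pcoord b d.
Proof.
apply/rowP => -[[|[|[|[|[|[|[|n]]]]]]] lt_n] //; rewrite !mxE /sp2_inner /pbasis /=;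
  rewrite hadj_mx2 mx2_mul mxtrace_mx2 /qi /qj /qk /qone -/rsqrt2 !qE.
1-3: by ring.
(* Horizontal coordinates carry the square of [rsqrt2], which is isolated before being replaced by
   1/2. *)
all: match goal with |- _ = ?x => transitivity (rsqrt2 * rsqrt2 * (2 * x)) end.
all: by [ring|rewrite rsqrt2_sqr; field].
Qed.

Lemma pproj_lie X Y :
  lie_p X Y = pcoord (horiz X * vert Y - horiz Y * vert X)
    (2^-1 *: (qconj (horiz Y) * horiz X - qconj (horiz X) * horiz Y)
     + (vert X * vert Y - vert Y * vert X)).
Proof.
rewrite /lie_p /lie !pvecE !mx2_mul mx2_sub -(pproj_skew 
  (rsqrt2 *: (horiz X) * (- (rsqrt2 *: qconj (horiz Y))) - rsqrt2 *: (horiz Y) * (- (rsqrt2 *: qconj (horiz X))))).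
congr pproj; congr mx2; apply: quatP; rewrite /vert /horiz !qE.
all: try by ring.
all: match goal with |- _ = 2^-1 * ?x + ?y => transitivity (rsqrt2 * rsqrt2 * x + y) end.
all: by [ring|rewrite rsqrt2_sqr].
Qed.

(** The bracket freed of quaternions and of sqrt 2, in coordinates on [nat]: the form from which the
    structure constants can be evaluated. *)
Definition lie_coord (x y : nat -> R) (n : nat) : R :=
  let w i j := x i * y j - x j * y i in
  match n with
  | 0 => 2 * w 1%N 2%N + w 3%N 6%N + w 4%N 5%N
  | 1 => - (2 * w 0%N 2%N) - w 3%N 5%N + w 4%N 6%N
  | 2 => 2 * w 0%N 1%N + w 3%N 4%N + w 5%N 6%N
  | 3 => - w 0%N 6%N + w 1%N 5%N - w 2%N 4%N
  | 4 => - w 0%N 5%N - w 1%N 6%N + w 2%N 3%N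
  | 5 => w 0%N 4%N - w 1%N 3%N - w 2%N 6%N
  | _ => w 0%N 3%N + w 1%N 4%N + w 2%N 5%N
  end.

Lemma lie_pE X Y n : (n < 7)%N ->
  lie_p X Y ord0 (inord n) =
    lie_coord (fun k => X ord0 (inord k)) (fun k => Y ord0 (inord k)) n.
Proof.
move: n => [|[|[|[|[|[|[|n]]]]]]] // _; rewrite pproj_lie mxE inordK //= /lie_coord /vert /horiz !qE.
all: by field.
Qed.

(** Conjugation by diag(h, 1) multiplies the upper right entry by h on the left and does not touch
    the lower right one. *)
Lemma AdE (h : quat R) X : Ad h X = pcoord (h * horiz X) (vert X).
Proof.
rewrite /Ad /Sp1_in_Sp2 pvecE hadj_mx2 !mx2_mul -(pproj_skew 0).
congr pproj; congr mx2; apply: quatP; rewrite /vert /horiz !qE; ring.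
Qed.

End QuaternionComputations.

(** * Differential and Hodge star on lists *)

Section FormsCalculus.
Variable R : realType.
Implicit Types (a b : extform R) (m : seq bool) (l : seq (R * seq bool)).
Implicit Types (S T : {set 'I_7}) (X : 'rV[R]_7).

Fixpoint munit (k n : nat) : seq bool :=
  match k, n with
  | 0, _ => [::]
  | k'.+1, 0 => true :: nseq k' false
  | k'.+1, n'.+1 => false :: munit k' n'
  end.

Lemma size_munit k n : size (munit k n) = k.
Proof. by elim: k n => // k IH [|n] /=; rewrite ?size_nseq ?IH. Qed.

Lemma wf_munit k : wf [:: (1 : R, munit 7 k)].
Proof. by rewrite /wf all_seq1 size_munit. Qed.

Lemma munitE (n : 'I_7) : mset (munit 7 n) = [set n].
Proof.
apply/setP => i; rewrite !inE -val_eqE /=.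
by case: n => [[|[|[|[|[|[|[|n]]]]]]] lt_n] //=; case: i => [[|[|[|[|[|[|[|i]]]]]]] lt_i].
Qed.

Lemma covecE (n : 'I_7) : covec R n = form_of [:: (1, munit 7 n)].
Proof.
by apply/ffunP => S; rewrite form_of_cons form_of_nil addr0 scale1r !ffunE munitE.
Qed.

Lemma mset0 : mset (nseq 7 false) = set0.
Proof. by apply/setP => i; rewrite !inE nth_nseq if_same. Qed.

Lemma foneE : fone R = form_of [:: (1, nseq 7 false)].
Proof.
by apply/ffunP => S; rewrite form_of_cons form_of_nil addr0 scale1r !ffunE mset0.
Qed.

Fixpoint lee (s : seq nat) : seq (R * seq bool) :=
  if s is k :: t then lwedge [:: (1, munit 7 k.-1)] (lee t)
  else [:: (1, nseq 7 false)].

Lemma wf_lee s : wf (lee s).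
Proof.
by elim: s => // k s IH; apply: wf_lwedge; rewrite ?wf_munit.
Qed.

Lemma eeE s : all (fun k => k.-1 < 7)%N s -> ee R s = form_of (lee s).
Proof.
elim: s => [|k s IH] /=; first by rewrite -foneE.
case/andP=> ltk /IH es; rewrite /ee /= -/(ee R s) es.
by rewrite covecE inordK // -form_of_wedge ?wf_munit ?wf_lee.
Qed.

Fixpoint ldext (dc : seq (seq (R * seq bool))) (n : nat) l : seq (R * seq bool) :=
  if dc is d :: dc' then lcat (lwedge d (liota n l)) (ldext dc' n.+1 l) else [::].

Lemma form_of_dext dc l : size dc = 7%N -> all (@wf R) dc -> wf l ->
  (forall n : 'I_7, dcovec R n = form_of (nth [::] dc n)) ->
  form_of (ldext dc 0 l) = dext (form_of l).
Proof.
move=> sd wd wl dcE; rewrite /dext.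
have -> : \sum_(n < 7) wedge (dcovec R n) (iota_ (pvect R n) (form_of l)) =
    \sum_(n < 7) form_of (lwedge (nth [::] dc n) (liota n l)).
  apply: eq_bigr => n _; rewrite dcE form_of_wedge ?form_of_iota ?wf_liota //.
  by apply: (all_nthP [::] wd); rewrite sd.
rewrite -(big_mkord xpredT (fun n => form_of (lwedge (nth [::] dc n) (liota n l)))).
case: dc sd {wd dcE} => [|d0 [|d1 [|d2 [|d3 [|d4 [|d5 [|d6 []]]]]]]] // _.
by rewrite /index_iota /= !form_of_lcat !big_cons big_nil form_of_nil.
Qed.

Fixpoint mweight (w : nat -> R) (n : nat) m : R :=
  if m is x :: s then (if x then w n else 1) * mweight w n.+1 s else 1.

Definition mneg m := map negb m.

(** For a diagonal metric, the star of e^S is a multiple of e^{S'} with S' the complement: the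
    factor is the product of the inverse metric entries [w] over S, times the volume factor [v],
    with the sign of e^S /\ e^{S'}. *)
Definition lhodge (w : nat -> R) (v : R) l : seq (R * seq bool) :=
  [seq (msgn (minv p.2 (mneg p.2)) (p.1 * mweight w 0 p.2 * v), mneg p.2) | p <- l].

Lemma mnegE m : size m = 7%N -> mset (mneg m) = ~: mset m.
Proof.
by move=> sm; apply/setP => i; rewrite !inE (nth_map false) ?sm.
Qed.

Lemma enum_pairwise S : pairwise (fun i j : 'I_7 => (i < j)%N) (enum S).
Proof.
rewrite /enum_mem pairwise_filter // -enumT /=.
by rewrite -(pairwise_map val ltn) val_enum_ord -sorted_pairwise ?iota_ltn_sorted //; apply: ltn_trans.
Qed.

Lemma prod_mweight (w : nat -> R) m : size m = 7%N ->
  \prod_(n <- enum (mset m)) w n = mweight w 0 m.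
Proof.
move=> sm; rewrite big_enum /= big_mkcond /=.
transitivity (\prod_(0 <= n < 7) if nth false m n then w n else 1).
  by rewrite big_mkord; apply: eq_bigr => n _; rewrite in_mset.
case: m sm => [|b0 [|b1 [|b2 [|b3 [|b4 [|b5 [|b6 []]]]]]]] // _.
by rewrite /index_iota /= !big_cons big_nil.
Qed.

Lemma invmx_diag n (d : 'rV[R]_n) : (forall i, d ord0 i != 0) ->
  invmx (diag_mx d) = diag_mx (\row_i (d ord0 i)^-1).
Proof.
move=> d0; have dd : diag_mx d *m diag_mx (\row_i (d ord0 i)^-1) = 1%:M.
  rewrite mulmx_diag -diag_const_mx; congr diag_mx.
  by apply/rowP => i; rewrite !mxE divff.
by rewrite -[LHS]mulmx1 -dd mulKmx //; case/mulmx1_unit: dd.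
Qed.

Lemma hodge_form_of (g : 'rV[R]_7) l : wf l -> (forall i, g ord0 i != 0) ->
  hodge (diag_mx g) (form_of l) =
    form_of (lhodge (fun n => (g ord0 (inord n))^-1) (Num.sqrt (\prod_i g ord0 i)) l).
Proof.
move=> wl g0; set w : nat -> R := fun n => (g ord0 (inord n))^-1; set v := Num.sqrt _.
have wh : wf (lhodge w v l).
  by elim: l wl => //= p l IH /andP[sp wl]; rewrite size_map sp IH.
apply: form_eq => m sm; rewrite form_of_coef // ffunE det_diag -/v invmx_diag //.
have sn : size (mneg m) = 7%N by rewrite size_map.
rewrite -mnegE // sgn_shuffleE //.
have -> : feval (form_of l) [seq row n (diag_mx (\row_i (g ord0 i)^-1)) | n <- enum (mset (mneg m))]
    = mweight w 0 (mneg m) * coef (mneg m) l.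
  rewrite /feval (@eq_map _ _ _ (fun n : 'I_7 => w n *: pvect R n)); last first.
    by move=> n; rewrite row_diag_mx mxE /w inord_val.
  rewrite foldl_iota_pairwise ?enum_pairwise //; last by move=> i j _; rewrite inE.
  by rewrite prod_mweight // set_enum setU0 form_of_coef.
have nK : mneg (mneg m) = m by rewrite /mneg mapK //; exact: negbK.
elim: l wl {wh} => [|p l IH] /=; first by rewrite mulr0 mulr0 mul0r.
case/andP=> /eqP sp wl; rewrite -IH //.
have -> : meq (mneg p.2) m = meq p.2 (mneg m).
  by apply/meqP/meqP => [<-|->] //; rewrite /mneg mapK //; exact: negbK.
case: meqP => // ->; rewrite nK !msgnE; ring.
Qed.

Definition homog (k : nat) a := forall S, #|S| != k -> a S = 0.

(** Each contraction adds one new index, so only coefficients on sets of cardinal [size Xs] are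
    reached. This disposes of the argument lists of wrong length over which [invariant]
    quantifies. *)
Lemma feval_homog k a (Xs : seq 'rV[R]_7) : homog k a -> size Xs != k -> feval a Xs = 0.
Proof.
move=> ha sX; rewrite /feval.
have : (#|set0 : {set 'I_7}| + size Xs)%N != k by rewrite cards0.
elim/last_ind: Xs {sX} set0 => [|Xs X IH] S; first by rewrite addn0 => /ha.
rewrite size_rcons foldl_rcons ffunE => ne; rewrite big1 // => n nS.
by rewrite IH ?mulr0 // cardsU1 nS addSn -addnS.
Qed.

Lemma card_mset m : size m = 7%N -> #|mset m| = count id m.
Proof.
move=> sm; rewrite -sum1_card big_mkcond /=.
transitivity (\sum_(0 <= n < 7) nth false m n)%N.
  by rewrite big_mkord; apply: eq_bigr => n _; rewrite in_mset; case: nth.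
case: m sm => [|b0 [|b1 [|b2 [|b3 [|b4 [|b5 [|b6 []]]]]]]] // _.
by rewrite /index_iota /= !big_cons big_nil.
Qed.

Lemma homog_form_of k l :
  all (fun p : R * seq bool => (size p.2 == 7%N) && (count id p.2 == k)) l ->
  homog k (form_of l).
Proof.
elim: l => [|p l IH] /=; first by move=> _ S _; rewrite form_of_nil ffunE.
case/andP=> /andP[/eqP sp /eqP cp] /IH hl S Sk; rewrite form_of_cons !ffunE hl // addr0.
case: eqP => [e|_]; last by rewrite [_ *: _]mulr0.
by rewrite e card_mset // cp eqxx in Sk.
Qed.

Definition mlist m : seq nat := [seq i <- iota 0 7 | mnth i m].

Lemma enum_mset m : enum (mset m) = [seq inord i | i <- mlist m].
Proof.
rewrite /mlist; have {1}-> : mset m = [set i : 'I_7 | mnth i m].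
  by apply/setP => i; rewrite !inE mnthE.
rewrite /enum_mem -enumT; have -> : enum 'I_7 = [seq inord i | i <- iota 0 7].
  by rewrite -val_enum_ord -map_comp map_id_in // => i _; exact: inord_val.
rewrite filter_map; congr (map _ _); apply: eq_in_filter => i; rewrite mem_iota => /= lti.
by rewrite !inE inordK.
Qed.
End FormsCalculus.

(** * Structure constants of p *)

Section StructureConstants.
Variable R : realType.
Implicit Types (a b : extform R) (m : seq bool) (l : seq (R * seq bool)).

Definition idx_mask (s : seq nat) : seq bool :=
  foldr (fun k m => mor (munit 7 k.-1) m) (nseq 7 false) s.

Definition ndelta (i k : nat) : R := if mnth k (munit 7 i) then 1 else 0.

Lemma ndeltaE i k : (i < 7)%N -> (k < 7)%N ->
  pvect R (inord i) ord0 (inord k) = ndelta i k.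
Proof.
move=> lti ltk; rewrite mxE eqxx /= -val_eqE /= !inordK // /ndelta mnthE.
have := in_mset (munit 7 i) (Ordinal ltk); rewrite /= => <-.
by rewrite (munitE (Ordinal lti)) inE -val_eqE /=; case: eqP.
Qed.

Lemma eq_lie_coord (x x' y y' : nat -> R) n :
  (forall k, (k < 7)%N -> x k = x' k) -> (forall k, (k < 7)%N -> y k = y' k) ->
  lie_coord x y n = lie_coord x' y' n.
Proof.
move=> ex ey; rewrite /lie_coord.
by case: n => [|[|[|[|[|[|n]]]]]]; rewrite !ex ?ey.
Qed.

Definition dterm (n i j : nat) : R * seq bool :=
  (- lie_coord (ndelta i) (ndelta j) n, mor (munit 7 i) (munit 7 j)).

Definition ldcovec (n : nat) : seq (R * seq bool) :=
  [:: dterm n 0 1; dterm n 0 2; dterm n 0 3; dterm n 0 4; dterm n 0 5; dterm n 0 6;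
      dterm n 1 2; dterm n 1 3; dterm n 1 4; dterm n 1 5; dterm n 1 6;
      dterm n 2 3; dterm n 2 4; dterm n 2 5; dterm n 2 6;
      dterm n 3 4; dterm n 3 5; dterm n 3 6;
      dterm n 4 5; dterm n 4 6; dterm n 5 6].

Lemma dtermE n i j : (n < 7)%N -> (i < j < 7)%N ->
  (- lie_p (pvect R (inord i)) (pvect R (inord j)) ord0 (inord n))
     *: wedge (covec R (inord i)) (covec R (inord j)) =
  (dterm n i j).1 *: mono R (dterm n i j).2.
Proof.
move=> ltn /andP[ltij ltj]; have lti := ltn_trans ltij ltj.
congr (- _ *: _).
  rewrite lie_pE //; apply: eq_lie_coord => k ltk; exact: ndeltaE.
rewrite !covecE -form_of_wedge ?wf_munit // !inordK //.
(* With literal indices both sides compute, and i < j makes the sign of e^i /\ e^j positive. *)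
by do 7?[case: i ltij lti => [|i] ltij lti //]; do 7?[case: j ltij ltj => [|j] ltij ltj //];
  rewrite form_of_cons form_of_nil addr0 /= mulr1 scale1r.
Qed.

Lemma sum_pairs7 (V : nmodType) (F : nat -> nat -> V) :
  \sum_(0 <= i < 7) \sum_(0 <= j < 7) (if (i < j)%N then F i j else 0) =
  (F 0%N 1%N + (F 0%N 2%N + (F 0%N 3%N + (F 0%N 4%N + (F 0%N 5%N + (F 0%N 6%N +
    (F 1%N 2%N + (F 1%N 3%N + (F 1%N 4%N + (F 1%N 5%N + (F 1%N 6%N + (F 2%N 3%N +
    (F 2%N 4%N + (F 2%N 5%N + (F 2%N 6%N + (F 3%N 4%N + (F 3%N 5%N + (F 3%N 6%N +
    (F 4%N 5%N + (F 4%N 6%N + (F 5%N 6%N))))))))))))))))))))).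
Proof. by rewrite /index_iota /= !big_cons !big_nil /= !add0r !addr0 -!addrA. Qed.

Lemma dcovecE (n : 'I_7) : dcovec R n = form_of (ldcovec n).
Proof.
pose F (i j : 'I_7) : extform R :=
  (- lie_p (pvect R i) (pvect R j) ord0 n) *: wedge (covec R i) (covec R j).
transitivity (\sum_(0 <= i < 7) \sum_(0 <= j < 7)
   if (i < j)%N then F (inord i) (inord j) else 0).
  rewrite big_mkord; apply: eq_bigr => i _; rewrite big_mkord big_mkcond.
  by apply: eq_bigr => j _; rewrite !inord_val.
have FE i j : (i < j < 7)%N ->
    F (inord i) (inord j) = (dterm n i j).1 *: mono R (dterm n i j).2.
  by move=> h; rewrite /F -(dtermE (ltn_ord n) h) inord_val.
rewrite (sum_pairs7 (fun i j => F (inord i) (inord j))).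
do 21 (rewrite FE; last by []).
by rewrite /ldcovec !form_of_cons form_of_nil addr0.
Qed.

(* Entry n is de^{n+1}. *)
Definition strconst : seq (seq (R * seq bool)) :=
  [:: [:: (- 2, idx_mask [:: 2; 3]%N); (-1, idx_mask [:: 4; 7]%N); (-1, idx_mask [:: 5; 6]%N)];
      [:: (2, idx_mask [:: 1; 3]%N); (1, idx_mask [:: 4; 6]%N); (-1, idx_mask [:: 5; 7]%N)];
      [:: (- 2, idx_mask [:: 1; 2]%N); (-1, idx_mask [:: 4; 5]%N); (-1, idx_mask [:: 6; 7]%N)];
      [:: (1, idx_mask [:: 1; 7]%N); (-1, idx_mask [:: 2; 6]%N); (1, idx_mask [:: 3; 5]%N)];
      [:: (1, idx_mask [:: 1; 6]%N); (1, idx_mask [:: 2; 7]%N); (-1, idx_mask [:: 3; 4]%N)];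
      [:: (-1, idx_mask [:: 1; 5]%N); (1, idx_mask [:: 2; 4]%N); (1, idx_mask [:: 3; 7]%N)];
      [:: (-1, idx_mask [:: 1; 4]%N); (-1, idx_mask [:: 2; 5]%N); (-1, idx_mask [:: 3; 6]%N)]].

End StructureConstants.

(* Runs the list combinatorics but leaves the operations of R folded. *)
Ltac lcbv := cbv beta iota zeta delta
  [meq mdisj mor mpar minv mdel mnth mtake msgn lmul1 lcat lwedge lscale liota
   coef lnorm mmem muniq lioX munit lee ldext mweight mneg lhodge mlist idx_mask
   ndelta lie_coord dterm ldcovec strconst
   map foldr nseq ncons iter all size seq.filter iota nth fst snd nat_of_ord addb andb orb negb xorb predn
   ].

Section InvariantDerivative.
Variable R : realType.

(** The reduction behind the computations of psi, d phi, d psi and tau_1: an identity of forms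
    becomes one scalar identity per key. *)
Lemma form_of_coefP (l l' : seq (R * seq bool)) ks :
  covers ks l -> covers ks l' -> (forall k, mmem k ks -> coef k l = coef k l') ->
  form_of l = form_of l'.
Proof.
move=> cl cl' e; rewrite (form_of_lnorm cl) (form_of_lnorm cl').
congr form_of; rewrite /lnorm; case/and4P: cl => _ _ _ _; clear cl'.
elim: ks e => //= k ks IH e; rewrite e; last by case: meqP.
by rewrite IH // => k' k'ks; apply: e; rewrite k'ks orbT.
Qed.

(** Of the 21 coefficients given by the bracket only three survive for each n; working with the
    short table keeps all later differentials small. *)
Lemma strconstE (n : 'I_7) : dcovec R n = form_of (nth [::] (strconst R) n).
Proof.
pose ks := map idx_mask [:: [::1;2]%N;[::1;3];[::1;4];[::1;5];[::1;6];[::1;7];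
  [::2;3];[::2;4];[::2;5];[::2;6];[::2;7];[::3;4];[::3;5];[::3;6];[::3;7];
  [::4;5];[::4;6];[::4;7];[::5;6];[::5;7];[::6;7]]%N.
rewrite dcovecE; case: n => [[|[|[|[|[|[|[|n]]]]]]] lt_n] //.
all: rewrite [LHS](@form_of_lnorm _ ks) // [RHS](@form_of_lnorm _ ks) //.
all: congr form_of; rewrite /ks; lcbv.
all: by do ![congr (_ :: _); first by congr (_, _); ring].
Qed.
End InvariantDerivative.

(** * Invariant 3-forms and their Hitchin form *)

Section ThreeForms.
Variable R : realType.
Implicit Types (a : R) (b : nat -> nat -> R) (B : 'M[R]_3) (l : seq (R * seq bool)).

(* This is [Phi r D] for a = r^3 and B = D^-1. *)
Definition three_form a B : extform R :=
  a *: ee R [:: 1; 2; 3]%N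
  + \sum_(i < 3) \sum_(j < 3) B i j *: wedge (ee R [:: j.+1]%N) (omega R i).

Definition three_list a b : seq (R * seq bool) :=
  [:: (a, idx_mask [:: 1; 2; 3]%N);
      (b 0 0, idx_mask [:: 1; 4; 7]%N); (b 0 0, idx_mask [:: 1; 5; 6]%N);
      (b 0 1, idx_mask [:: 2; 4; 7]%N); (b 0 1, idx_mask [:: 2; 5; 6]%N);
      (b 0 2, idx_mask [:: 3; 4; 7]%N); (b 0 2, idx_mask [:: 3; 5; 6]%N);
      (b 1 0, idx_mask [:: 1; 4; 6]%N); (- b 1 0, idx_mask [:: 1; 5; 7]%N);
      (b 1 1, idx_mask [:: 2; 4; 6]%N); (- b 1 1, idx_mask [:: 2; 5; 7]%N);
      (b 1 2, idx_mask [:: 3; 4; 6]%N); (- b 1 2, idx_mask [:: 3; 5; 7]%N);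
      (b 2 0, idx_mask [:: 1; 4; 5]%N); (b 2 0, idx_mask [:: 1; 6; 7]%N);
      (b 2 1, idx_mask [:: 2; 4; 5]%N); (b 2 1, idx_mask [:: 2; 6; 7]%N);
      (b 2 2, idx_mask [:: 3; 4; 5]%N); (b 2 2, idx_mask [:: 3; 6; 7]%N)]%N.

Definition mx_entry B (i j : nat) : R := B (inord i) (inord j).

Lemma sum_ord3 (V : nmodType) (F : 'I_3 -> V) :
  \sum_(i < 3) F i = F (inord 0) + (F (inord 1) + F (inord 2)).
Proof.
transitivity (\sum_(0 <= n < 3) F (inord n)).
  by rewrite big_mkord; apply: eq_bigr => i _; rewrite inord_val.
by rewrite /index_iota /= !big_cons big_nil addr0.
Qed.

Definition lomega (i : nat) : seq (R * seq bool) :=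
  match i with
  | 0 => lcat (lee R [:: 4; 7]%N) (lee R [:: 5; 6]%N)
  | 1 => lcat (lee R [:: 4; 6]%N) (lscale (-1) (lee R [:: 5; 7]%N))
  | _ => lcat (lee R [:: 4; 5]%N) (lee R [:: 6; 7]%N)
  end.

Lemma omegaE i : (i < 3)%N -> omega R (inord i) = form_of (lomega i).
Proof.
move=> lti; rewrite /omega inordK //; case: i lti => [|[|[|i]]] // _;
  by rewrite /lomega form_of_lcat ?form_of_scale ?scaleN1r -!eeE.
Qed.

Definition lterm b i j := lscale (b i j) (lwedge (lee R [:: j.+1]) (lomega i)).

Lemma ltermE B i j : (i < 3)%N -> (j < 3)%N ->
  B (inord i) (inord j) *: wedge (ee R [:: (inord j : 'I_3).+1]%N) (omega R (inord i)) =
  form_of (lterm (mx_entry B) i j).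
Proof.
move=> lti ltj; rewrite omegaE // inordK // eeE; last first.
  by rewrite /= andbT (ltn_trans ltj).
have wo : wf (lomega i).
  by case: i {lti} => [|[|i]]; rewrite /lomega wf_lcat ?wf_lscale !wf_lee.
by rewrite -form_of_wedge ?wf_lee // -form_of_scale.
Qed.

Lemma three_formE a B : three_form a B = form_of (three_list a (mx_entry B)).
Proof.
rewrite /three_form !sum_ord3 !ltermE // eeE // -form_of_scale -!form_of_lcat.
move: (mx_entry B) => b {B}.
pose ks := map idx_mask [:: [::1;2;3];[::1;4;7];[::1;5;6];[::2;4;7];[::2;5;6];[::3;4;7];[::3;5;6];
  [::1;4;6];[::1;5;7];[::2;4;6];[::2;5;7];[::3;4;6];[::3;5;7];
  [::1;4;5];[::1;6;7];[::2;4;5];[::2;6;7];[::3;4;5];[::3;6;7]]%N.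
rewrite [LHS](@form_of_lnorm _ ks) // [RHS](@form_of_lnorm _ ks) //.
congr form_of; rewrite /ks /three_list /lterm /lomega; lcbv.
by do ![congr (_ :: _); first by congr (_, _); ring].
Qed.

Definition hitchin_entry a b (i j : nat) : R :=
  match i, j with
  | 3, 3 | 4, 4 | 5, 5 | 6, 6 => 
   b 0%N 0%N * (b 1%N 1%N * b 2%N 2%N - b 1%N 2%N * b 2%N 1%N) - b 0%N 1%N * (b 1%N 0%N * b 2%N 2%N - b 1%N 2%N * b 2%N 0%N)
   + b 0%N 2%N * (b 1%N 0%N * b 2%N 1%N - b 1%N 1%N * b 2%N 0%N)
  | (0|1|2), (0|1|2) => a * (b 0%N i * b 0%N j + b 1%N i * b 1%N j + b 2%N i * b 2%N j)
  | _, _ => 0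
  end.

Lemma hitchinE a b i j : (i < 7)%N -> (j < 7)%N ->
  hitchin_form (form_of (three_list a b)) (inord i) (inord j) = hitchin_entry a b i j.
Proof.
move=> lti ltj; rewrite mxE.
have w : wf (three_list a b) by [].
rewrite -!form_of_iota // -!form_of_wedge ?wf_lwedge ?wf_liota // !inordK //.
have -> : [set: 'I_7] = mset (nseq 7 true).
  by apply/setP => k; rewrite !inE nth_nseq ltn_ord.
rewrite form_of_coef ?wf_lwedge ?wf_liota //.
move: i lti => [|[|[|[|[|[|[|i]]]]]]] // _;
  move: j ltj => [|[|[|[|[|[|[|j]]]]]]] // _.
all: rewrite /three_list /hitchin_entry; lcbv.
all: by field.
Qed.
End ThreeForms.

(** * The induced metric *)

Section Metric.
Variable R : realType.
Implicit Types (a r : R) (b : nat -> nat -> R) (B : 'M[R]_3) (l : seq (R * seq bool)).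

Lemma prod_ord7 (F : 'I_7 -> R) :
  \prod_(i < 7) F i = F (inord 0) * (F (inord 1) * (F (inord 2) * (F (inord 3)
    * (F (inord 4) * (F (inord 5) * F (inord 6)))))).
Proof.
transitivity (\prod_(0 <= n < 7) F (inord n)).
  by rewrite big_mkord; apply: eq_bigr => i _; rewrite inord_val.
by rewrite /index_iota /= !big_cons big_nil mulr1.
Qed.

Definition ndet b : R :=
  let c (i j k n : nat) := b i j * b k n - b i n * b k j in
  b 0%N 0%N * c 1%N 1%N 2%N 2%N - b 0%N 1%N * c 1%N 0%N 2%N 2%N
  + b 0%N 2%N * c 1%N 0%N 2%N 1%N.

Lemma det3 B : \det B = ndet (mx_entry B).
Proof.
have {1}-> : B = \matrix_(i, j) mx_entry B i j by apply/matrixP => i j; rewrite mxE /mx_entry !inord_val.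
move: (mx_entry _) => b.
rewrite (expand_det_row _ ord0) !big_ord_recl big_ord0 /cofactor.
rewrite !(expand_det_row _ ord0) !big_ord_recl !big_ord0 /cofactor !det_mx11 !mxE /=.
rewrite /ndet /bump /= !addn0 /=; ring.
Qed.

Definition rotation B := B^T *m B = 1%:M /\ \det B = 1.

Lemma g_gt0 r (i : 'I_7) : 0 < r -> 0 < (\row_(n < 7) if (n < 3)%N then r ^+ 2 else r^-1) ord0 i.
Proof. by move=> r0; rewrite mxE; case: ifP => _; rewrite ?exprn_gt0 ?invr_gt0. Qed.

Lemma det_g r : 0 < r -> \prod_(i < 7) (\row_(n < 7) if (n < 3)%N then r ^+ 2 else r^-1) ord0 i = r ^+ 2.
Proof. by move=> r0; rewrite prod_ord7 !mxE !inordK //=; field; rewrite gt_eqF. Qed.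

Lemma hitchin_three a B : hitchin_form (three_form a B) = \matrix_(i, j) hitchin_entry a (mx_entry B) i j.
Proof.
by apply/matrixP => i j; rewrite three_formE -{1}(inord_val i) -{1}(inord_val j) hitchinE // mxE.
Qed.

Lemma tr_mul3 B (i j : nat) : (i < 3)%N -> (j < 3)%N -> let b := mx_entry B in
  (B^T *m B) (inord i) (inord j) = b 0%N i * b 0%N j + b 1%N i * b 1%N j + b 2%N i * b 2%N j.
Proof. by move=> lti ltj b; rewrite mxE sum_ord3 !mxE /b /mx_entry addrA. Qed.

Lemma hitchin_rotation r B : 0 < r -> rotation B ->
  hitchin_form (three_form (r ^+ 3) B) = r *: g_ r.
Proof.
move=> r0 [BB dB]; rewrite hitchin_three; apply/matrixP => i j; rewrite !mxE.
have e k n : (k < 3)%N -> (n < 3)%N -> mx_entry B 0%N k * mx_entry B 0%N n + mx_entry B 1%N k * mx_entry B 1%N n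
    + mx_entry B 2%N k * mx_entry B 2%N n = (k == n)%:R.
  by move=> ltk ltn; rewrite -tr_mul3 // BB mxE -val_eqE /= !inordK.
have rr : r * r^-1 = 1 by rewrite divff // gt_eqF.
case: i => [[|[|[|[|[|[|[|i]]]]]]] lt_i] //; case: j => [[|[|[|[|[|[|[|j]]]]]]] lt_j] //;
  rewrite /hitchin_entry /= -?[X in X = _]/(ndet (mx_entry B)) -?det3 ?e // ?dB ?mulr0n ?mulr1n ?mulr0 ?mulr1 ?rr //;
  by rewrite -exprS.
Qed.

(** Since det g_r = r^2, the Hitchin form r g_r has determinant r^9, and the normalising factor is
    exactly 1/r. *)
Lemma metric_rotation r B : 0 < r -> rotation B -> metric (three_form (r ^+ 3) B) = g_ r.
Proof.
move=> r0 sB; rewrite /metric hitchin_rotation // detZ det_diag det_g // -exprD.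
rewrite -powR_mulrn ?ltW // -powRrM.
have -> : 9%:R * - (9 : R)^-1 = -1 by field.
by rewrite powR_inv1 ?ltW // scalerA mulVf ?scale1r // gt_eqF.
Qed.

Lemma powR9 (x : R) : 0 < x -> (x `^ (- 9^-1)) ^+ 9 * x = 1.
Proof.
move=> x0; rewrite -powR_mulrn ?powR_ge0 // -powRrM.
have -> : - (9 : R)^-1 * 9%:R = -1 by field.
by rewrite powR_inv1 ?ltW // mulVf // gt_eqF.
Qed.

(** Once the conformal factor is known to be 1/r, the horizontal block gives det B = 1 and the
    vertical one a B^T B = r^3; the determinant of the latter gives a^3 = (r^3)^3, and cubing is
    injective on the reals. *)
Lemma metric_three_inv r a B : 0 < r -> metric (three_form a B) = g_ r ->
  a = r ^+ 3 /\ rotation B.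
Proof.
move=> r0; rewrite /metric; set H := hitchin_form _; set c := _ `^ _ => cH.
have c0 : 0 < c.
  rewrite lt_neqAle powR_ge0 andbT eq_sym; apply/eqP => c0; move/matrixP: cH.
  move=> /(_ ord0 ord0); rewrite c0 !mxE /= mul0r => /esym/eqP.
  by rewrite mulr1n expf_eq0 /= gt_eqF.
have dH : c ^+ 7 * \det H = r ^+ 2 by rewrite -detZ cH det_diag det_g.
(* The power law for [powR] is available for a positive base, so the sign of det H is recovered
   first. *)
have d0 : 0 < \det H by rewrite -(pmulr_rgt0 _ (exprn_gt0 7 c0)) dH exprn_gt0.
have c9 := powR9 d0; rewrite -/c in c9.
(* c^9 det H = 1 and c^7 det H = det g_r = r^2, hence (c r)^2 = 1 *)
have cr : c * r = 1.
  apply/eqP; rewrite -sqrp_eq1 ?mulr_ge0 ?ltW // exprMn -dH mulrA -exprD.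
  by rewrite c9.
have HE i j : H i j = r * g_ r i j by rewrite -cH [(c *: H) i j]mxE mulrA [r * c]mulrC cr mul1r.
have HE' (i j : nat) : (i < 7)%N -> (j < 7)%N -> hitchin_entry a (mx_entry B) i j = r * g_ r (inord i) (inord j).
  by move=> lti ltj; rewrite -HE /H hitchin_three mxE !inordK.
have dB : \det B = 1.
  by have := HE' 3 3 isT isT; rewrite !mxE eqxx !inordK //= mulr1n divff ?gt_eqF // det3.
have aBB : a *: (B^T *m B) = (r ^+ 3)%:M.
  apply/matrixP => i j; rewrite -(inord_val i) -(inord_val j) [LHS]mxE tr_mul3 // [RHS]mxE.
  have -> : (inord i == inord j :> 'I_3) = (i == j :> nat) by rewrite !inord_val.
  have lt7 (k : 'I_3) : (k < 7)%N by case: k => k /= ltk; apply: leq_trans ltk _.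
  have := HE' i j (lt7 i) (lt7 j); rewrite !mxE -val_eqE /= !inordK //.
  rewrite ltn_ord; case: i => [[|[|[|i]]] lt_i] //; case: j => [[|[|[|j]]] lt_j] //= ->;
  by rewrite ?mulr0n ?mulr1n ?mulr0 -?exprS.
have a3 : a ^+ 3 = (r ^+ 3) ^+ 3.
  by have := congr1 determinant aBB; rewrite detZ det_mulmx det_tr dB !mulr1 det_scalar.
have ar : a = r ^+ 3.
  apply/eqP; rewrite -subr_eq0; have : (a - r ^+ 3) * (a ^+ 2 + a * r ^+ 3 + (r ^+ 3) ^+ 2) == 0.
    by apply/eqP; transitivity (a ^+ 3 - (r ^+ 3) ^+ 3); [ring|rewrite a3 subrr].
  rewrite mulf_eq0 => /orP[//|/eqP e].
  have s0 : 0 < (r ^+ 3) ^+ 2 by rewrite !exprn_gt0.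
  suff : 0 < a ^+ 2 + a * r ^+ 3 + (r ^+ 3) ^+ 2 by rewrite e ltxx.
  have -> : a ^+ 2 + a * r ^+ 3 + (r ^+ 3) ^+ 2 =
    (a + 2^-1 * r ^+ 3) ^+ 2 + (3 / 4) * (r ^+ 3) ^+ 2 by field.
  by rewrite ltr_wpDl ?sqr_ge0 // mulr_gt0 // divr_gt0.
split => //; split => //; apply/matrixP => i j.
have r3 : r ^+ 3 != 0 by rewrite gt_eqF ?exprn_gt0.
apply: (mulfI r3); move/matrixP/(_ i j): aBB; rewrite ar !mxE => ->.
by rewrite mulr_natr.
Qed.
End Metric.

(** * Invariance under Ad(Sp(1)) *)

Section Invariance.
Variable R : realType.
Implicit Types (a r : R) (b : nat -> nat -> R) (B : 'M[R]_3) (l : seq (R * seq bool)).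
Implicit Types (f : extform R).

Lemma eq_lioX (x x' : nat -> R) l : (forall k, (k < 7)%N -> x k = x' k) ->
  lioX x l = lioX x' l.
Proof. by move=> e; rewrite /lioX !e. Qed.

Definition leval l (x y z : nat -> R) : R :=
  coef (nseq 7 false) (lioX z (lioX y (lioX x l))).

Lemma feval3E l (X Y Z : 'rV[R]_7) x y z : wf l ->
  (forall k, (k < 7)%N -> X ord0 (inord k) = x k) ->
  (forall k, (k < 7)%N -> Y ord0 (inord k) = y k) ->
  (forall k, (k < 7)%N -> Z ord0 (inord k) = z k) ->
  feval (form_of l) [:: X; Y; Z] = leval l x y z.
Proof.
move=> wl ex ey ez; rewrite feval3_form_of // /leval.
by rewrite (eq_lioX _ ez) (eq_lioX _ ey) (eq_lioX _ ex).
Qed.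

Definition omega_eval (i : nat) (y z : nat -> R) : R :=
  let w (p q : nat) := y p * z q - y q * z p in
  match i with
  | 0 => w 3%N 6%N + w 4%N 5%N
  | 1 => w 3%N 5%N - w 4%N 6%N
  | _ => w 3%N 4%N + w 5%N 6%N
  end.

Definition leval_three a b (x y z : nat -> R) : R :=
  let e (i j : nat) := x j * omega_eval i y z - y j * omega_eval i x z + z j * omega_eval i x y in
  let d (p q : nat) := y p * z q - y q * z p in
  a * (x 0%N * d 1%N 2%N - x 1%N * d 0%N 2%N + x 2%N * d 0%N 1%N)
  + (b 0%N 0%N * e 0%N 0%N + b 0%N 1%N * e 0%N 1%N + b 0%N 2%N * e 0%N 2%N
    + (b 1%N 0%N * e 1%N 0%N + b 1%N 1%N * e 1%N 1%N + b 1%N 2%N * e 1%N 2%N)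
    + (b 2%N 0%N * e 2%N 0%N + b 2%N 1%N * e 2%N 1%N + b 2%N 2%N * e 2%N 2%N)).

Lemma leval_threeE a b x y z : leval (three_list a b) x y z = leval_three a b x y z.
Proof. by rewrite /leval /three_list /leval_three /omega_eval; lcbv; ring. Qed.

Definition Ad_coord (h : quat R) (x : nat -> R) (k : nat) : R :=
  let b := h * qmk (x 6%N) (x 3%N) (x 4%N) (x 5%N) in
  match k with
  | 0 => x 0%N | 1 => x 1%N | 2 => x 2%N
  | 3 => q1 b | 4 => q2 b | 5 => q3 b | _ => q0 b
  end.

Lemma Ad_coordE h (X : 'rV[R]_7) k : (k < 7)%N ->
  Ad h X ord0 (inord k) = Ad_coord h (fun n => X ord0 (inord n)) k.
Proof.
move=> ltk; rewrite AdE mxE inordK //.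
by move: k ltk => [|[|[|[|[|[|[|k]]]]]]] // _ /=; rewrite /vert ?qE.
Qed.

(** Up to sign the omega_i are the imaginary components of conj(y) z, which left multiplication by h
    scales by |h|^2 = 1. *)
Lemma omega_eval_Ad i h (y z : nat -> R) : S3 h -> omega_eval i (Ad_coord h y) (Ad_coord h z) = omega_eval i y z.
Proof.
move=> hS; rewrite -[RHS]mul1r -[1]hS; case: i => [|[|i]];
  by rewrite /omega_eval /Ad_coord !qE; ring.
Qed.

Lemma three_homog a B : homog 3 (three_form a B).
Proof. by rewrite three_formE; apply: homog_form_of. Qed.

Lemma three_invariant a B : Defs.invariant (three_form a B).
Proof.
move=> h hS Xs; have hm := three_homog a B.
have [s3|n3] := eqVneq (size Xs) 3; last by rewrite !(feval_homog hm) ?size_map.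
case: Xs s3 => [|X [|Y [|Z []]]] // _ /=; rewrite three_formE.
pose c (X : 'rV[R]_7) n := X ord0 (inord n).
have wl : wf (three_list a (mx_entry B)) by [].
transitivity (leval (three_list a (mx_entry B)) (Ad_coord h (c X)) (Ad_coord h (c Y)) (Ad_coord h (c Z))).
  by apply: feval3E => // k ltk; rewrite Ad_coordE.
transitivity (leval (three_list a (mx_entry B)) (c X) (c Y) (c Z)); last by symmetry; apply: feval3E.
by rewrite !leval_threeE /leval_three !omega_eval_Ad.
Qed.

Lemma G2_modelE : G2_model R = form_of (three_list 1 (ndelta R)).
Proof.
transitivity (three_form 1 (1%:M : 'M[R]_3)); last first.
  rewrite three_formE /three_list /mx_entry !mxE -!val_eqE /= !inordK //.
rewrite /G2_model /three_form scale1r; congr (_ + _); apply: eq_bigr => i _.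
rewrite (bigD1 i) //= big1 ?addr0 ?mxE ?eqxx ?scale1r // => j /negbTE ji.
by rewrite mxE eq_sym ji scale0r.
Qed.

Lemma pullback_homog k (A : 'M[R]_7) f : homog k f -> homog k (pullback A f).
Proof.
by move=> hf S Sk; rewrite ffunE (feval_homog hf) // size_map -cardE.
Qed.

Lemma G2_structure_homog f : G2_structure f -> homog 3 f.
Proof.
case=> A _ ->; apply: pullback_homog; rewrite G2_modelE; exact: homog_form_of.
Qed.
End Invariance.

(** * Invariant G2-structures inducing g_r *)

Section Characterization.
Variable R : realType.
Implicit Types (a r : R) (b : nat -> nat -> R) (B : 'M[R]_3) (l : seq (R * seq bool)).
Implicit Types (f : extform R) (m : seq bool).

(** All 35 triples: first the 19 that occur in [three_list], then the 16 with an odd number of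
    horizontal indices. *)
Definition masks3 : seq (seq bool) := map idx_mask
  [:: [::1;2;3];
      [::1;4;7];[::1;5;6];[::2;4;7];[::2;5;6];[::3;4;7];[::3;5;6];
      [::1;4;6];[::1;5;7];[::2;4;6];[::2;5;7];[::3;4;6];[::3;5;7];
      [::1;4;5];[::1;6;7];[::2;4;5];[::2;6;7];[::3;4;5];[::3;6;7];
      [::1;2;4];[::1;2;5];[::1;2;6];[::1;2;7];[::1;3;4];[::1;3;5];[::1;3;6];[::1;3;7];
      [::2;3;4];[::2;3;5];[::2;3;6];[::2;3;7];[::4;5;6];[::4;5;7];[::4;6;7];[::5;6;7]]%N.

Lemma mmemP (P : seq bool -> Prop) ks :
  foldr (fun k Q => P k /\ Q) True ks -> forall m, mmem m ks -> P m.
Proof.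
elim: ks => //= k ks IH [Pk Pks] m; case: meqP => [<- //|_] /=; exact: IH.
Qed.

Lemma masks3P m : size m = 7%N -> count id m = 3%N -> mmem m masks3.
Proof.
case: m => [|b0 [|b1 [|b2 [|b3 [|b4 [|b5 [|b6 []]]]]]]] // _.
by case: b0; case: b1; case: b2; case: b3; case: b4; case: b5; case: b6.
Qed.

Lemma form3_eq f f' : homog 3 f -> homog 3 f' ->
  (forall m, mmem m masks3 -> f (mset m) = f' (mset m)) -> f = f'.
Proof.
move=> hf hf' e; apply: form_eq => m sm.
have [c3|n3] := eqVneq (count id m) 3; first by apply: e; apply: masks3P.
by rewrite hf ?hf' // card_mset.
Qed.

(** Vertical covectors get weight -2 in s and horizontal ones weight 1, so the terms e^l /\ omega_i
    keep their size, B mixing the e^l, while e^{123} is scaled by s^{-6}, which is r^3 for r =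
    s^{-2}. *)
Definition blockA (s : R) B : 'M[R]_7 :=
  @block_mx R 3 4 3 4 ((s ^+ 2)^-1 *: B^T) 0 0 s%:M.

Definition blockA_entry (s : R) b (i k : nat) : R :=
  match i, k with
  | 3, 3 | 4, 4 | 5, 5 | 6, 6 => s
  | (0|1|2), (0|1|2) => (s ^+ 2)^-1 * b k i
  | _, _ => 0
  end.

Lemma blockAE s B (i k : nat) : (i < 7)%N -> (k < 7)%N ->
  blockA s B (inord i) (inord k) = blockA_entry s (mx_entry B) i k.
Proof.
have lt3 (n : nat) : (n < 3)%N -> inord n = lshift 4 (inord n : 'I_3).
  by move=> ltn; apply: val_inj; rewrite /= !inordK // (leq_trans ltn).
have lt4 (n : nat) : (n < 4)%N -> inord (3 + n) = rshift 3 (inord n : 'I_4).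
  by move=> ltn; apply: val_inj; rewrite /= !inordK // -[7%N]/(3 + 4)%N ltn_add2l.
have e4 (p q : nat) : (p < 4)%N -> (q < 4)%N ->
    blockA s B (inord (3 + p)) (inord (3 + q)) = s *+ (p == q).
  move=> ltp ltq; rewrite (lt4 p) // (lt4 q) //; apply: (etrans (block_mxEdr _ _ _ _ _ _)).
  by rewrite mxE -val_eqE /= !inordK.
move=> lti ltk.
have [i3|i3] := ltnP i 3; have [k3|k3] := ltnP k 3.
- rewrite (lt3 i) // (lt3 k) //; apply: (etrans (block_mxEul _ _ _ _ _ _)); rewrite !mxE /mx_entry.
  by case: i i3 {lti} => [|[|[|i]]] // _; case: k k3 {ltk} => [|[|[|k]]].
- rewrite (lt3 i) // -(subnKC k3) (lt4 (k - 3)%N) ?ltn_subLR //; apply: (etrans (block_mxEur _ _ _ _ _ _)); rewrite mxE.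
  by case: i i3 {lti} => [|[|[|i]]] // _; case: k k3 {ltk} => [|[|[|k]]].
- rewrite (lt3 k) // -(subnKC i3) (lt4 (i - 3)%N) ?ltn_subLR //; apply: (etrans (block_mxEdl _ _ _ _ _ _)); rewrite mxE.
  by case: k k3 {ltk} => [|[|[|k]]] // _; case: i i3 {lti} => [|[|[|[|[|[|[|i]]]]]]].
rewrite -(subnKC i3) -(subnKC k3) e4 ?ltn_subLR //.
by case: k k3 ltk => [|[|[|[|[|[|[|k]]]]]]] // _ _; case: i i3 lti => [|[|[|[|[|[|[|i]]]]]]].
Qed.

Lemma det_blockA s B : 0 < s -> \det B = 1 -> 0 < \det (blockA s B).
Proof.
move=> s0 dB; have -> : \det (blockA s B) = (s ^+ 2)^-1 ^+ 3 * s ^+ 4.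
  apply: (etrans (@det_ublock R 3 4 _ _ _)).
  by rewrite detZ det_tr dB mulr1 det_scalar.
by rewrite mulr_gt0 ?exprn_gt0 ?invr_gt0 ?exprn_gt0.
Qed.

Definition is3list (s : seq nat) := 
  if s is [:: i; j; k] then [&& i < 7, j < 7 & k < 7]%N else false.

Lemma pullback3 (A : 'M[R]_7) (blockA_entry : nat -> nat -> R) l m : wf l ->
  (forall i k, (i < 7)%N -> (k < 7)%N -> A (inord i) (inord k) = blockA_entry i k) ->
  is3list (mlist m) ->
  pullback A (form_of l) (mset m) =
    leval l (blockA_entry (nth 0 (mlist m) 0)%N) (blockA_entry (nth 0 (mlist m) 1)%N)
      (blockA_entry (nth 0 (mlist m) 2)%N).
Proof.
move=> wl eA; rewrite ffunE enum_mset; case: (mlist m) => [|i [|j [|k []]]] //=.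
case/and3P=> lti ltj ltk; apply: feval3E => // n ltn; by rewrite mxE eA.
Qed.

Lemma three_G2 s B : 0 < s -> rotation B ->
  G2_structure (three_form (((s ^+ 2)^-1) ^+ 3) B).
Proof.
move=> s0 [BB dB]; exists (blockA s B); first exact: det_blockA.
apply: form3_eq; first exact: three_homog.
  by apply: pullback_homog; rewrite G2_modelE; exact: homog_form_of.
have sn : s != 0 by rewrite gt_eqF.
have db : ndet (mx_entry B) = 1 by rewrite -det3.
rewrite G2_modelE three_formE; move: db; move: (mx_entry B) (@blockAE s B) => b eA db.
apply: mmemP; rewrite /masks3; cbv [map foldr].
pose l1 : seq (R * seq bool) := three_list 1 (ndelta R).
have pb m : mmem m masks3 -> is3list (mlist m) ->
  pullback (blockA s B) (form_of l1) (mset m) =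
    leval_three 1 (ndelta R) (blockA_entry s b (nth 0 (mlist m) 0)%N)
      (blockA_entry s b (nth 0 (mlist m) 1)%N) (blockA_entry s b (nth 0 (mlist m) 2)%N).
  by move=> _ m3; rewrite (pullback3 _ eA) // leval_threeE.
have l3 m : size m = 7%N -> form_of (three_list ((s ^+ 2)^-1 ^+ 3) b) (mset m)
    = coef m (three_list ((s ^+ 2)^-1 ^+ 3) b) by move=> sm; rewrite form_of_coef.
split.
  rewrite pb // l3 // /three_list /leval_three /omega_eval; lcbv; cbv beta iota delta [blockA_entry].
  (* The coefficient of e^{123}: B acts on the vertical volume form by det B = 1. *)
  transitivity ((s ^+ 2)^-1 ^+ 3 * ndet b); first by rewrite db; ring.
  by rewrite /ndet; field.
do 34 (split;
  [by rewrite pb // l3 // /three_list /leval_three /omega_eval; lcbv; cbv beta iota delta [blockA_entry]; field|]).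
by [].
Qed.

Definition form3_list f : seq (R * seq bool) := [seq (f (mset k), k) | k <- masks3].

Lemma form3_listE f : homog 3 f -> f = form_of (form3_list f).
Proof.
move=> hf; apply: form3_eq => //; first exact: homog_form_of.
apply: mmemP; rewrite /form3_list /masks3; cbv [map foldr].
by do 35 (split; [by rewrite form_of_coef //; lcbv; rewrite addr0|]).
Qed.

Lemma iota_Zl (c : R) X (f : extform R) : iota_ (c *: X) f = c *: iota_ X f.
Proof.
apply/ffunP => S; rewrite !ffunE [RHS]mulr_sumr; apply: eq_bigr => k _.
by rewrite mxE /= !mulrA.
Qed.

Lemma feval3_pvect l (c d e : R) (p q t : 'I_7) : wf l ->
  feval (form_of l) [:: c *: pvect R p; d *: pvect R q; e *: pvect R t] =
  c * d * e * coef (nseq 7 false) (liota t (liota q (liota p l))).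
Proof.
move=> wl; rewrite /feval /= !iota_Zl !iota_Zr -!form_of_iota ?wf_liota //.
rewrite -mset0 !scalerA ffunE form_of_coef ?wf_liota //.
by congr (_ * _); ring.
Qed.

Lemma S3_units : S3 (- qone R) /\ S3 (qi R) /\ S3 (qj R).
Proof. by rewrite /S3 /qone /qi /qj /= !qE; do !split; ring. Qed.

(* The units -1, i and j act on the basis of p by signed permutations, and their
   invariants are already all the Ad(Sp(1))-invariants: -1 removes the forms of
   odd degree in e^4, ..., e^7, and i and j the anti-self-dual part of
   Lambda^2 <e^4, ..., e^7>. *)
Definition signed_action (h : quat R) (sg : nat -> bool * nat) :=
  forall p, (p < 7)%N -> ((sg p).2 < 7)%N /\
    Ad h (pvect R (inord p)) = msgn (sg p).1 1 *: pvect R (inord (sg p).2).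

Lemma signed_actionP h sg :
  (forall p, (p < 7)%N -> ((sg p).2 < 7)%N /\ forall k, (k < 7)%N ->
     Ad_coord h (ndelta R p) k = msgn (sg p).1 (ndelta R (sg p).2 k)) -> signed_action h sg.
Proof.
move=> e p ltp; have [lts ek] := e p ltp; split => //; apply/rowP => k.
rewrite -(inord_val k) Ad_coordE // [RHS]mxE ndeltaE //.
transitivity (Ad_coord h (ndelta R p) k); first by rewrite /Ad_coord; cbv beta; rewrite !ndeltaE.
by rewrite ek // !msgnE mulr1.
Qed.

Lemma ltn7_ind (P : nat -> Prop) :
  P 0%N -> P 1%N -> P 2%N -> P 3%N -> P 4%N -> P 5%N -> P 6%N -> forall k, (k < 7)%N -> P k.
Proof. by move=> ? ? ? ? ? ? ? [|[|[|[|[|[|[|k]]]]]]]. Qed.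

(** Left multiplication tables, with indices 3, 4, 5, 6 standing for i, j, k, 1; the boolean is true
    when the image carries a minus sign. *)
Definition act_m1 (p : nat) : bool * nat :=
  match p with 0 | 1 | 2 => (false, p) | _ => (true, p) end%N.
Definition act_i (p : nat) : bool * nat :=
  match p with 3 => (true, 6) | 4 => (false, 5) | 5 => (true, 4) | 6 => (false, 3)
  | _ => (false, p) end%N.
Definition act_j (p : nat) : bool * nat :=
  match p with 3 => (true, 5) | 4 => (true, 6) | 5 => (false, 3) | 6 => (false, 4)
  | _ => (false, p) end%N.

Lemma signed_action_units : signed_action (- qone R) act_m1 /\
  signed_action (qi R) act_i /\ signed_action (qj R) act_j.
Proof.
have e1 x : forall k, (k < 7)%N -> Ad_coord (- qone R) x k =
    [:: x 0%N; x 1%N; x 2%N; - x 3%N; - x 4%N; - x 5%N; - x 6%N]`_k.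
  by apply: ltn7_ind; rewrite /Ad_coord /qone ?qE /=; ring.
have ei x : forall k, (k < 7)%N -> Ad_coord (qi R) x k =
    [:: x 0%N; x 1%N; x 2%N; x 6%N; - x 5%N; x 4%N; - x 3%N]`_k.
  by apply: ltn7_ind; rewrite /Ad_coord /qi ?qE /=; ring.
have ej x : forall k, (k < 7)%N -> Ad_coord (qj R) x k =
    [:: x 0%N; x 1%N; x 2%N; x 5%N; x 6%N; - x 3%N; - x 4%N]`_k.
  by apply: ltn7_ind; rewrite /Ad_coord /qj ?qE /=; ring.
split; [|split]; apply: signed_actionP; apply: ltn7_ind; (split; first by []); apply: ltn7_ind;
  rewrite ?e1 ?ei ?ej //; cbv [act_m1 act_i act_j]; lcbv;
  by rewrite ?oppr0.
Qed.

(** Invariance on a triple of basis vectors becomes a linear relation between coefficients. Iterated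
    contractions are kept because the images may come in another order, and the contractions supply
    the reordering sign. *)
Lemma signed_action_coef f h sg : homog 3 f -> Defs.invariant f -> S3 h ->
  signed_action h sg -> forall m, is3list (mlist m) ->
  let n k := nth 0%N (mlist m) k in
  let o := nseq 7 false in
  msgn (addb (sg (n 0%N)).1 (addb (sg (n 1%N)).1 (sg (n 2%N)).1))
    (coef o (liota (sg (n 2%N)).2 (liota (sg (n 1%N)).2 (liota (sg (n 0%N)).2 (form3_list f))))) =
  coef o (liota (n 2%N) (liota (n 1%N) (liota (n 0%N) (form3_list f)))).
Proof.
move=> hf hi hS hsg m m3 n o; have wl : wf (form3_list f) by [].
suff /and3P[lt0 lt1 lt2] : [&& n 0 < 7, n 1 < 7 & n 2 < 7]%N; last first.
  by rewrite /n; case: (mlist m) m3 => [|i [|j [|k []]]].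
have [[u0 e0] [u1 e1] [u2 e2]] := And3 (hsg _ lt0) (hsg _ lt1) (hsg _ lt2).
have := hi h hS [:: pvect R (inord (n 0%N)); pvect R (inord (n 1%N)); pvect R (inord (n 2%N))].
rewrite [map _ _]/= e0 e1 e2 {1 2}(form3_listE hf) => e.
have := feval3_pvect 1 1 1 (inord (n 0%N)) (inord (n 1%N)) (inord (n 2%N)) wl.
rewrite !scale1r !mul1r -e (feval3_pvect _ _ _ _ _ _ wl).
rewrite (inordK lt0) (inordK lt1) (inordK lt2) (inordK u0) (inordK u1) (inordK u2) => <-.
rewrite !msgnE !mulr1 !signr_addb !mulrA; reflexivity.

Qed.

Lemma invariant_three f : homog 3 f -> Defs.invariant f -> exists a B, f = three_form a B.
Proof.
move=> hf hi; have [S1 [Si Sj]] := S3_units.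
have [A1 [Ai Aj]] := signed_action_units.
pose fc (i j k : nat) := f (mset (idx_mask [:: i; j; k])).
(* B is read on the leading monomials e^{47}, e^{46}, e^{45} of omega_1, omega_2, omega_3. *)
exists (fc 1 2 3)%N, (\matrix_(i, j) match nat_of_ord i with
  | 0 => fc (j.+1) 4 7 | 1 => fc (j.+1) 4 6 | _ => fc (j.+1) 4 5 end)%N.
apply: form3_eq => //; first exact: three_homog.
move=> m mm3; have sm : size m = 7%N by move: m mm3; apply: mmemP; do !split.
rewrite three_formE form_of_coef // /three_list /mx_entry !mxE !inordK //; move: m mm3 {sm}.
have E1 m := @signed_action_coef f _ _ hf hi S1 A1 m.
have Ei m := @signed_action_coef f _ _ hf hi Si Ai m.
have Ej m := @signed_action_coef f _ _ hf hi Sj Aj m.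
apply: mmemP; rewrite /masks3; cbv [map foldr].
(* The leading monomials hold by choice of B; invariance under j or i ties the second monomial of
   each omega_i to the first; invariance under -1 equates each remaining coefficient with its
   opposite. *)
do 35 (split; [match goal with |- @eq _ ?x _ => match x with context [mset ?m] =>
  first
  [ by lcbv; cbv [fc]; lcbv; rewrite addr0
  | by have := Ej m isT; rewrite /form3_list /masks3 /act_j; lcbv; cbv [fc]; lcbv; lra
  | by have := Ei m isT; rewrite /form3_list /masks3 /act_i; lcbv; cbv [fc]; lcbv; lra
  | by have := E1 m isT; rewrite /form3_list /masks3 /act_m1; lcbv; cbv [fc]; lcbv; lra ]
  end end|]); exact: I.
Qed.

Lemma rotation_G2 r B : 0 < r -> rotation B -> invariant_G2 (three_form (r ^+ 3) B).
Proof.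
move=> r0 sB; split; last exact: three_invariant.
(* The horizontal scale s = r^{-1/2} solves s^{-2} = r. *)
have s0 : 0 < (Num.sqrt r)^-1 by rewrite invr_gt0 sqrtr_gt0.
have -> : r = (((Num.sqrt r)^-1) ^+ 2)^-1 by rewrite exprVn invrK sqr_sqrtr // ltW.
exact: three_G2.
Qed.

Lemma invariant_G2_three r f : 0 < r ->
  (invariant_G2 f /\ metric f = g_ r) <-> (exists2 B, rotation B & f = three_form (r ^+ 3) B).
Proof.
move=> r0; split=> [[[fG fI] fm]|[B sB ->]].
  have [a [B fE]] := invariant_three (G2_structure_homog fG) fI.
  by move: fm; rewrite fE => /(metric_three_inv r0) [-> sB]; exists B.
by split; [exact: rotation_G2|exact: metric_rotation].
Qed.

Lemma calB_three_form r f : calB r f <-> (exists2 B, rotation B & f = three_form (r ^+ 3) B).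
Proof.
have inv (D D' : 'M[R]_3) : D *m D' = 1%:M -> invmx D = D'.
  by move=> DD; case/mulmx1_unit: (DD) => uD _; rewrite -[LHS]mulmx1 -DD mulKmx.
split=> [[D [DD dD] <-]|[B [BB dB] ->]].
  exists D^T; first by split; rewrite ?trmxK ?det_tr.
  by rewrite /Phi (inv _ _ DD).
exists B^T; first by split; rewrite ?trmxK ?det_tr.
by rewrite /Phi (inv _ _ BB).
Qed.
End Characterization.

(** * psi, d psi and d phi as explicit lists *)

Section TorsionForms.
Variable R : realType.
Implicit Types (r : R) (b : nat -> nat -> R) (B : 'M[R]_3) (l : seq (R * seq bool)).
Implicit Types (f : extform R) (m : seq bool).

Definition g_weight r (n : nat) : R := match n with 0 | 1 | 2 => (r ^+ 2)^-1 | _ => r end.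

(** The volume factor is r because det g_r = r^6 r^{-4} = r^2. *)
Definition lstar r l := lhodge (g_weight r) r l.

Lemma star_g r l : 0 < r -> wf l -> hodge (g_ r) (form_of l) = form_of (lstar r l).
Proof.
move=> r0 wl; rewrite /g_ hodge_form_of //; last by move=> i; rewrite gt_eqF ?g_gt0.
rewrite det_g // sqrtr_sqr gtr0_norm //; congr form_of.
rewrite /lstar /lhodge; apply/eq_in_map => p pl.
have /eqP sp : size p.2 == 7%N by move/allP: wl => /(_ p pl).
congr (msgn _ (_ * _ * _), _).
case: (p.2) sp => [|b0 [|b1 [|b2 [|b3 [|b4 [|b5 [|b6 []]]]]]]] // _.
by rewrite /= !mxE !inordK //= !invrK.
Qed.

Lemma starE r B l : 0 < r -> rotation B -> wf l ->
  star (three_form (r ^+ 3) B) (form_of l) = form_of (lstar r l).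
Proof. by move=> r0 sB wl; rewrite /star metric_rotation // star_g. Qed.

Lemma coef_form_of m l l' : wf l -> wf l' -> size m = 7%N -> form_of l = form_of l' ->
  coef m l = coef m l'.
Proof. by move=> wl wl' sm e; rewrite -!form_of_coef // e. Qed.

Definition psi_list r b : seq (R * seq bool) :=
  [:: ((r ^+ 2)^-1, idx_mask [:: 4; 5; 6; 7]%N);
      (r * b 0%N 0%N, idx_mask [:: 2; 3; 5; 6]%N); (r * b 0%N 0%N, idx_mask [:: 2; 3; 4; 7]%N);
      (- (r * b 0%N 1%N), idx_mask [:: 1; 3; 5; 6]%N); (- (r * b 0%N 1%N), idx_mask [:: 1; 3; 4; 7]%N);
      (r * b 0%N 2%N, idx_mask [:: 1; 2; 5; 6]%N); (r * b 0%N 2%N, idx_mask [:: 1; 2; 4; 7]%N);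
      (- (r * b 1%N 0%N), idx_mask [:: 2; 3; 5; 7]%N); (r * b 1%N 0%N, idx_mask [:: 2; 3; 4; 6]%N);
      (r * b 1%N 1%N, idx_mask [:: 1; 3; 5; 7]%N); (- (r * b 1%N 1%N), idx_mask [:: 1; 3; 4; 6]%N);
      (- (r * b 1%N 2%N), idx_mask [:: 1; 2; 5; 7]%N); (r * b 1%N 2%N, idx_mask [:: 1; 2; 4; 6]%N);
      (r * b 2%N 0%N, idx_mask [:: 2; 3; 6; 7]%N); (r * b 2%N 0%N, idx_mask [:: 2; 3; 4; 5]%N);
      (- (r * b 2%N 1%N), idx_mask [:: 1; 3; 6; 7]%N); (- (r * b 2%N 1%N), idx_mask [:: 1; 3; 4; 5]%N);
      (r * b 2%N 2%N, idx_mask [:: 1; 2; 6; 7]%N); (r * b 2%N 2%N, idx_mask [:: 1; 2; 4; 5]%N)].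

Definition keys4 : seq (seq bool) := map idx_mask
  [:: [:: 4; 5; 6; 7]; [:: 2; 3; 5; 6]; [:: 2; 3; 4; 7]; [:: 1; 3; 5; 6]; [:: 1; 3; 4; 7];
      [:: 1; 2; 5; 6]; [:: 1; 2; 4; 7]; [:: 2; 3; 5; 7]; [:: 2; 3; 4; 6]; [:: 1; 3; 5; 7];
      [:: 1; 3; 4; 6]; [:: 1; 2; 5; 7]; [:: 1; 2; 4; 6]; [:: 2; 3; 6; 7]; [:: 2; 3; 4; 5];
      [:: 1; 3; 6; 7]; [:: 1; 3; 4; 5]; [:: 1; 2; 6; 7]; [:: 1; 2; 4; 5]]%N.

Definition keys5 : seq (seq bool) := map idx_mask
  [:: [:: 1; 4; 5; 6; 7]; [:: 2; 4; 5; 6; 7]; [:: 3; 4; 5; 6; 7]; [:: 1; 2; 3; 6; 7];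
      [:: 1; 2; 3; 5; 7]; [:: 1; 2; 3; 5; 6]; [:: 1; 2; 3; 4; 6]; [:: 1; 2; 3; 4; 7];
      [:: 1; 2; 3; 4; 5]]%N.

(* The coefficients of d psi; they vanish when B diag(-1, 1, -1) is symmetric,
   i.e. when h j is real or purely imaginary. *)
Definition skew1 b : R := b 1%N 2%N + b 2%N 1%N.
Definition skew2 b : R := b 2%N 0%N - b 0%N 2%N.
Definition skew3 b : R := b 0%N 1%N + b 1%N 0%N.

Definition dpsi_list r b : seq (R * seq bool) :=
  [:: (- (2 * r * skew1 b), idx_mask [:: 1; 4; 5; 6; 7]%N); (2 * r * skew2 b, idx_mask [:: 2; 4; 5; 6; 7]%N);
      (2 * r * skew3 b, idx_mask [:: 3; 4; 5; 6; 7]%N); (- (2 * r * skew3 b), idx_mask [:: 1; 2; 3; 6; 7]%N);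
      (- (2 * r * skew2 b), idx_mask [:: 1; 2; 3; 5; 7]%N); (2 * r * skew1 b, idx_mask [:: 1; 2; 3; 5; 6]%N);
      (2 * r * skew2 b, idx_mask [:: 1; 2; 3; 4; 6]%N); (2 * r * skew1 b, idx_mask [:: 1; 2; 3; 4; 7]%N);
      (- (2 * r * skew3 b), idx_mask [:: 1; 2; 3; 4; 5]%N)].

(** The terms in r^3 come from d(e^{123}), all others from the d(e^l /\ omega_i). *)
Definition dphi_list r b : seq (R * seq bool) :=
  let u := - (2 * (b 0%N 0%N + b 1%N 1%N - b 2%N 2%N)) - r ^+ 3 in
  let v := 2 * (b 0%N 0%N + b 1%N 1%N + b 2%N 2%N) - r ^+ 3 in
  let w := 2 * (b 0%N 0%N - b 1%N 1%N - b 2%N 2%N) - r ^+ 3 in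
  let x := 2 * (b 0%N 1%N - b 1%N 0%N) in
  let y := - (2 * (b 0%N 2%N + b 2%N 0%N)) in
  let z := 2 * (b 2%N 1%N - b 1%N 2%N) in
  [:: (- (2 * (b 0%N 0%N - b 1%N 1%N + b 2%N 2%N)), idx_mask [:: 4; 5; 6; 7]%N);
      (u, idx_mask [:: 2; 3; 5; 6]%N); (u, idx_mask [:: 2; 3; 4; 7]%N);
      (x, idx_mask [:: 1; 3; 5; 6]%N); (x, idx_mask [:: 1; 3; 4; 7]%N);
      (y, idx_mask [:: 1; 2; 5; 6]%N); (y, idx_mask [:: 1; 2; 4; 7]%N);
      (- x, idx_mask [:: 2; 3; 5; 7]%N); (x, idx_mask [:: 2; 3; 4; 6]%N);
      (- v, idx_mask [:: 1; 3; 5; 7]%N); (v, idx_mask [:: 1; 3; 4; 6]%N);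
      (- z, idx_mask [:: 1; 2; 5; 7]%N); (z, idx_mask [:: 1; 2; 4; 6]%N);
      (y, idx_mask [:: 2; 3; 6; 7]%N); (y, idx_mask [:: 2; 3; 4; 5]%N);
      (z, idx_mask [:: 1; 3; 6; 7]%N); (z, idx_mask [:: 1; 3; 4; 5]%N);
      (w, idx_mask [:: 1; 2; 6; 7]%N); (w, idx_mask [:: 1; 2; 4; 5]%N)].

Lemma star_three_list r b : 0 < r ->
  form_of (lstar r (three_list (r ^+ 3) b)) = form_of (psi_list r b).
Proof.
move=> r0; have rn : r != 0 by rewrite gt_eqF.
apply: (@form_of_coefP _ _ _ keys4); [by vm_compute|by vm_compute|].
apply: mmemP; rewrite /keys4; cbv [map foldr].
rewrite /lstar /three_list /psi_list.
by do 19 (split; [by lcbv; cbv [g_weight]; field|]).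
Qed.

Lemma dextE l : wf l -> dext (form_of l) = form_of (ldext (strconst R) 0 l).
Proof. by move=> wl; rewrite (form_of_dext _ _ wl (@strconstE R)). Qed.

Lemma dext_psi_list r b : dext (form_of (psi_list r b)) = form_of (dpsi_list r b).
Proof.
rewrite dextE //.
apply: (@form_of_coefP _ _ _ keys5); [by vm_compute|by vm_compute|].
apply: mmemP; rewrite /keys5; cbv [map foldr].
rewrite /dpsi_list /psi_list /skew1 /skew2 /skew3.
by do 9 (split; [by lcbv; ring|]).
Qed.

Lemma dext_three_list r b : dext (form_of (three_list (r ^+ 3) b)) = form_of (dphi_list r b).
Proof.
rewrite dextE //.
apply: (@form_of_coefP _ _ _ keys4); [by vm_compute|by vm_compute|].
apply: mmemP; rewrite /keys4; cbv [map foldr].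
rewrite /three_list /dphi_list.
by do 19 (split; [by lcbv; ring|]).
Qed.

Definition rot_entry (h : quat R) (i j : nat) : R :=
  let h0 := q0 h in let h1 := q1 h in let h2 := q2 h in let h3 := q3 h in
  match i, j with
  | 0, 0 => h0 ^+ 2 + h1 ^+ 2 - h2 ^+ 2 - h3 ^+ 2
  | 0, 1 => 2 * (h1 * h2 - h0 * h3)
  | 0, _ => 2 * (h1 * h3 + h0 * h2)
  | 1, 0 => 2 * (h1 * h2 + h0 * h3)
  | 1, 1 => h0 ^+ 2 - h1 ^+ 2 + h2 ^+ 2 - h3 ^+ 2
  | 1, _ => 2 * (h2 * h3 - h0 * h1)
  | _, 0 => 2 * (h1 * h3 - h0 * h2)
  | _, 1 => 2 * (h2 * h3 + h0 * h1)
  | _, _ => h0 ^+ 2 - h1 ^+ 2 - h2 ^+ 2 + h3 ^+ 2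
  end.

Lemma Upsilon_entry (h : quat R) i j : (i < 3)%N -> (j < 3)%N -> mx_entry (Upsilon h) i j = rot_entry h i j.
Proof.
move=> lti ltj; rewrite /mx_entry mxE !inordK //.
by case: i lti => [|[|[|i]]] //; case: j ltj => [|[|[|j]]].
Qed.

Lemma Upsilon_rotation (h : quat R) : S3 h -> rotation (Upsilon h).
Proof.
move=> hS; have h0E : q0 h ^+ 2 = 1 - q1 h ^+ 2 - q2 h ^+ 2 - q3 h ^+ 2 by rewrite -hS; ring.
split; last by rewrite det3 /ndet !Upsilon_entry // /rot_entry; ring: h0E.
apply/matrixP => i j; rewrite -(inord_val i) -(inord_val j) tr_mul3 // [RHS]mxE.
have -> : (inord i == inord j :> 'I_3) = (i == j :> nat) by rewrite !inord_val.
rewrite !Upsilon_entry //; case: i => [[|[|[|i]]] lt_i] //; case: j => [[|[|[|j]]] lt_j] //=;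
  by rewrite ?mulr0n ?mulr1n /rot_entry; ring: h0E.
Qed.
End TorsionForms.

(** * Torsion of phi_(r,h) *)

Section TorsionOfFamily.
Variable R : realType.
Implicit Types (r : R) (b : nat -> nat -> R) (B : 'M[R]_3) (l : seq (R * seq bool)) (h : quat R).

(** Conjugating h transposes [Upsilon h], and [Phi] inverts its argument; for a rotation the two
    operations cancel. *)
Lemma phi_three r h : S3 h -> phi r h = three_form (r ^+ 3) (Upsilon h).
Proof.
move=> hS; have [UU _] := Upsilon_rotation hS.
have -> : phi r h = Phi r (Upsilon h)^T.
  congr Phi; apply/matrixP => i j; rewrite !mxE /qconj !qmkE.
  by case: i => [[|[|[|i]]] lt_i] //; case: j => [[|[|[|j]]] lt_j] //=; ring.
rewrite /Phi; congr (_ + _).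
suff -> : invmx (Upsilon h)^T = Upsilon h by [].
by case/mulmx1_unit: (UU) => uU _; rewrite -[LHS]mulmx1 -UU mulKmx.
Qed.

Lemma eq_three_list a b b' : (forall i j, (i < 3)%N -> (j < 3)%N -> b i j = b' i j) ->
  three_list a b = three_list a b'.
Proof. by move=> e; rewrite /three_list !e. Qed.

Lemma phiE r h : S3 h -> phi r h = form_of (three_list (r ^+ 3) (rot_entry h)).
Proof. by move=> hS; rewrite phi_three // three_formE (eq_three_list _ (@Upsilon_entry R h)). Qed.

Lemma star_phi r h l : 0 < r -> S3 h -> wf l -> star (phi r h) (form_of l) = form_of (lstar r l).
Proof. by move=> r0 hS wl; rewrite phi_three // starE //; apply: Upsilon_rotation. Qed.

Lemma psi_phi r h : 0 < r -> S3 h -> psi (phi r h) = form_of (psi_list r (rot_entry h)).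
Proof. by move=> r0 hS; rewrite /psi {2}phiE // star_phi // star_three_list. Qed.

Lemma dext_phi r h : S3 h -> dext (phi r h) = form_of (dphi_list r (rot_entry h)).
Proof. by move=> hS; rewrite phiE // dext_three_list. Qed.

Lemma tau0_phi r h : 0 < r -> S3 h ->
  tau0 (phi r h) = - (4 / 7) * ((1 - 4 * q2 h ^+ 2) * (r ^+ 2 + 2 / r) + 3 / r).
Proof.
move=> r0 hS; rewrite /tau0 (dext_phi r hS) {2}(phiE r hS) -form_of_wedge; [|by []|by []].
rewrite (star_phi r0 hS); last by vm_compute.
rewrite -mset0 form_of_coef; [|by vm_compute|by []].
have rn : r != 0 by rewrite gt_eqF.
set b := rot_entry h.
(* For a rotation the nine squares add up to 3 and the three minors are B_33, B_22 (up to sign) and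
   B_11, so the long bracket is 3 + 2 T. *)
have -> : coef (nseq 7 false) (lstar r (lwedge (three_list (r ^+ 3) b) (dphi_list r b))) =
  - 4 / r * ((b 0%N 0%N ^+ 2 + b 0%N 1%N ^+ 2 + b 0%N 2%N ^+ 2) + (b 1%N 0%N ^+ 2 + b 1%N 1%N ^+ 2 + b 1%N 2%N ^+ 2)
       + (b 2%N 0%N ^+ 2 + b 2%N 1%N ^+ 2 + b 2%N 2%N ^+ 2)
     + 2 * (b 0%N 0%N * b 1%N 1%N - b 0%N 1%N * b 1%N 0%N) - 2 * (b 0%N 0%N * b 2%N 2%N - b 0%N 2%N * b 2%N 0%N)
     + 2 * (b 1%N 1%N * b 2%N 2%N - b 1%N 2%N * b 2%N 1%N)) - 4 * r ^+ 2 * (b 0%N 0%N - b 1%N 1%N + b 2%N 2%N).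
  by rewrite /lstar /three_list /dphi_list; lcbv; cbv [g_weight]; field.
have h0E : q0 h ^+ 2 = 1 - q1 h ^+ 2 - q2 h ^+ 2 - q3 h ^+ 2 by rewrite -hS; ring.
by rewrite /b /rot_entry; field: h0E.
Qed.

Definition tau1_list r b : seq (R * seq bool) :=
  let c := (r ^+ 3 + 2) / 6 in
  [:: (- (c * skew1 b), idx_mask [:: 1]%N); (c * skew2 b, idx_mask [:: 2]%N); (c * skew3 b, idx_mask [:: 3]%N)].

Definition keys1 : seq (seq bool) := map idx_mask
  [:: [:: 1]; [:: 2]; [:: 3]; [:: 4]; [:: 5]; [:: 6]; [:: 7]]%N.

Lemma tau1_phi r h : 0 < r -> S3 h ->
  tau1 (phi r h) = form_of (tau1_list r (rot_entry h)).
Proof.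
move=> r0 hS; rewrite /tau1 (dext_phi r hS) (star_phi r0 hS); last by [].
rewrite {2}(phiE r hS) -form_of_wedge; [|by []|by vm_compute].
rewrite (star_phi r0 hS); last by vm_compute.
rewrite -form_of_scale.
have rn : r != 0 by rewrite gt_eqF.
have h0E : q0 h ^+ 2 = 1 - q1 h ^+ 2 - q2 h ^+ 2 - q3 h ^+ 2 by rewrite -hS; ring.
(* Each off-diagonal entry equals its cofactor; this will absorb the quadratic part of tau_1. *)
have c12 : rot_entry h 1%N 2%N = rot_entry h 0%N 1%N * rot_entry h 2%N 0%N - rot_entry h 0%N 0%N * rot_entry h 2%N 1%N.
  by rewrite /rot_entry; ring: h0E.
have c21 : rot_entry h 2%N 1%N = rot_entry h 1%N 0%N * rot_entry h 0%N 2%N - rot_entry h 0%N 0%N * rot_entry h 1%N 2%N.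
  by rewrite /rot_entry; ring: h0E.
have c20 : rot_entry h 2%N 0%N = rot_entry h 0%N 1%N * rot_entry h 1%N 2%N - rot_entry h 0%N 2%N * rot_entry h 1%N 1%N.
  by rewrite /rot_entry; ring: h0E.
have c02 : rot_entry h 0%N 2%N = rot_entry h 1%N 0%N * rot_entry h 2%N 1%N - rot_entry h 1%N 1%N * rot_entry h 2%N 0%N.
  by rewrite /rot_entry; ring: h0E.
have c01 : rot_entry h 0%N 1%N = rot_entry h 1%N 2%N * rot_entry h 2%N 0%N - rot_entry h 1%N 0%N * rot_entry h 2%N 2%N.
  by rewrite /rot_entry; ring: h0E.
have c10 : rot_entry h 1%N 0%N = rot_entry h 0%N 2%N * rot_entry h 2%N 1%N - rot_entry h 0%N 1%N * rot_entry h 2%N 2%N.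
  by rewrite /rot_entry; ring: h0E.
move: (rot_entry h) c12 c21 c20 c02 c01 c10 => b c12 c21 c20 c02 c01 c10.
apply: (@form_of_coefP _ _ _ keys1); [by vm_compute|by vm_compute|].
apply: mmemP; rewrite /keys1; cbv [map foldr].
rewrite /tau1_list /lstar /three_list /dphi_list /skew1 /skew2 /skew3.
split.
  (* The linear part has factor r^3 / 6; the cofactors give the same combination with factor 1/3,
     whence (r^3 + 2) / 6. *)
  lcbv; cbv [g_weight]; transitivity (- (r ^+ 3 / 6 * (b 1%N 2%N + b 2%N 1%N) +
    3^-1 * ((b 0%N 1%N * b 2%N 0%N - b 0%N 0%N * b 2%N 1%N) + (b 1%N 0%N * b 0%N 2%N - b 0%N 0%N * b 1%N 2%N)))).
    by field.
  by rewrite -c12 -c21; field.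
split.
  lcbv; cbv [g_weight]; transitivity (r ^+ 3 / 6 * (b 2%N 0%N - b 0%N 2%N) +
    3^-1 * ((b 0%N 1%N * b 1%N 2%N - b 0%N 2%N * b 1%N 1%N) - (b 1%N 0%N * b 2%N 1%N - b 1%N 1%N * b 2%N 0%N))).
    by field.
  by rewrite -c20 -c02; field.
split.
  lcbv; cbv [g_weight]; transitivity (r ^+ 3 / 6 * (b 0%N 1%N + b 1%N 0%N) +
    3^-1 * ((b 1%N 2%N * b 2%N 0%N - b 1%N 0%N * b 2%N 2%N) + (b 0%N 2%N * b 2%N 1%N - b 0%N 1%N * b 2%N 2%N))).
    by field.
  by rewrite -c01 -c10; field.
by do 4 (split; [by lcbv; cbv [g_weight]; field|]).
Qed.

Lemma form_eq_coef l l' ks : all (fun k => size k == 7%N) ks -> wf l -> wf l' ->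
  form_of l = form_of l' -> foldr (fun k Q => coef k l = coef k l' /\ Q) True ks.
Proof.
move=> sk wl wl' e; elim: ks sk => //= k ks IH /andP[/eqP sk1 /IH {}IH]; split => //.
exact: coef_form_of.
Qed.

Lemma skewE h : (skew1 (rot_entry h) = 4 * q2 h * q3 h) *
  (skew2 (rot_entry h) = - (4 * q0 h * q2 h)) * (skew3 (rot_entry h) = 4 * q1 h * q2 h).
Proof. by rewrite /skew1 /skew2 /skew3 /rot_entry; do !split; ring. Qed.

Definition coclosed_eqs h := [/\ q2 h * q3 h = 0, q0 h * q2 h = 0 & q1 h * q2 h = 0].

(** If h2 is nonzero it can be cancelled from the three equations, and the norm leaves h2 = 1 or
    -1. *)
Lemma coclosed_eqsP h : S3 h -> coclosed_eqs h <-> equator h \/ poles h.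
Proof.
move=> hS; split=> [[e3 e0 e1]|]; last first.
  case=> [[_ e]|[->|->]]; rewrite /coclosed_eqs; first by rewrite e; split; ring.
    by rewrite /qj !qE; split; ring.
  by rewrite /qj !qE; split; ring.
have [e2|n2] := eqVneq (q2 h) 0; [by left|right].
move: e3 e0 e1 => /eqP + /eqP + /eqP; rewrite !mulf_eq0 (negbTE n2) ?orbF /= => /eqP e3 /eqP e0 /eqP e1.
have : q2 h ^+ 2 == 1 by apply/eqP; rewrite -hS e0 e1 e3; ring.
rewrite sqrf_eq1 => /orP[/eqP e2|/eqP e2]; [left|right]; apply: quatP;
  by rewrite /qj ?qE ?e0 ?e1 ?e2 ?e3 //; ring.
Qed.

Lemma coclosed_phi r h : 0 < r -> S3 h -> coclosed (phi r h) <-> coclosed_eqs h.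
Proof.
move=> r0 hS; rewrite /coclosed (psi_phi r0 hS) dext_psi_list.
have rn : r != 0 by rewrite gt_eqF.
rewrite -(form_of_nil R); split=> [e|[e3 e0 e1]].
  have := @form_eq_coef (dpsi_list r (rot_entry h)) [::] keys5 isT isT isT e.
  rewrite /keys5 /dpsi_list !skewE; cbv [map foldr]; lcbv; rewrite !addr0.
  case=> e14 [e24 [e34 _]]; move: e14 e24 e34.
  have c0 : 8 * r != 0 by rewrite mulf_neq0 ?pnatr_eq0.
  move=> e14 e24 e34; split; apply: (mulfI c0); rewrite mulr0.
  - by rewrite -[RHS]oppr0 -e14; ring.
  - by rewrite -[RHS]oppr0 -e24; ring.
  by rewrite -e34; ring.
apply: (@form_of_coefP _ _ _ keys5); [by vm_compute|by vm_compute|].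
apply: mmemP; rewrite /keys5 /dpsi_list !skewE; cbv [map foldr].
have z1 : 4 * q2 h * q3 h = 0 by rewrite -mulrA e3 mulr0.
have z2 : 4 * q0 h * q2 h = 0 by rewrite -mulrA e0 mulr0.
have z3 : 4 * q1 h * q2 h = 0 by rewrite -mulrA e1 mulr0.
rewrite z1 z2 z3.
by do 9 (split; [by lcbv; ring|]).
Qed.
End TorsionOfFamily.

(** * The torsion regimes *)

Section TorsionRegimes.
Variable R : realType.
Implicit Types (r : R) (l : seq (R * seq bool)) (h : quat R).

Lemma coclosed_cases h : S3 h -> coclosed_eqs h ->
  q2 h = 0 \/ [/\ q2 h ^+ 2 = 1, q0 h = 0, q1 h = 0 & q3 h = 0].
Proof.
move=> hS /(coclosed_eqsP hS) [[_ e]|[->|->]]; [by left|right|right];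
  by rewrite /qj !qE; split; ring.
Qed.

(** The factor T (r^2 + 2/r) + 3/r of tau_0 is r^2 + 5/r > 0 on the equator and -3 (r^2 + 1/r) < 0
    at the poles. *)
Lemma not_purely_coclosed_phi r h : 0 < r -> S3 h -> ~ purely_coclosed (phi r h).
Proof.
move=> r0 hS [/(coclosed_phi r0 hS) /(coclosed_cases hS)]; rewrite tau0_phi // => hq t0.
have rn : r != 0 by rewrite gt_eqF.
have x0 : 0 < r ^+ 2 by rewrite exprn_gt0.
have y0 : 0 < r^-1 by rewrite invr_gt0.
by case: hq t0 => [->|[-> _ _ _]]; lra.
Qed.

Lemma cube_root (c r : R) : 0 < c -> 0 < r -> (r = c `^ 3^-1) <-> r ^+ 3 = c.
Proof.
move=> c0 r0; split=> [->|<-].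
  by rewrite -powR_mulrn ?powR_ge0 // -powRrM mulVf ?pnatr_eq0 // powRr1 // ltW.
by rewrite -powR_mulrn ?ltW // -powRrM mulfV ?pnatr_eq0 // powRr1 // ltW.
Qed.

Lemma loc_conf_coclosed_phi r h : 0 < r -> S3 h ->
  loc_conf_coclosed (phi r h) <-> r = 1 \/ coclosed (phi r h).
Proof.
move=> r0 hS; have rn : r != 0 by rewrite gt_eqF.
rewrite /loc_conf_coclosed (coclosed_phi r0 hS) (psi_phi r0 hS) dext_psi_list (tau1_phi r0 hS).
rewrite -form_of_wedge; [|by []|by []].
rewrite -form_of_scale.
have wl : wf (lscale 4 (lwedge (tau1_list r (rot_entry h)) (psi_list r (rot_entry h)))) by vm_compute.
split=> [e|].
  have := @form_eq_coef _ (dpsi_list r (rot_entry h)) _ keys5 isT isT wl e.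
  rewrite /keys5 /dpsi_list /tau1_list /psi_list !skewE; cbv [map foldr]; lcbv.
  case=> e14 [e24 [e34 _]].
  have [r1|r1] := eqVneq r 1; [by left|right].
  (* On e^{l4567} the two sides differ by (4/3) (r^3 - 1) / r^2 times a skew quantity, up to sign,
     and [skewE] contributes another factor 4. *)
  have c0 : 16 / 3 * (r ^+ 3 - 1) != 0.
    rewrite mulf_neq0 //; first by rewrite mulf_neq0 ?invr_eq0 ?pnatr_eq0.
    rewrite subr_eq0; apply: contra r1 => /eqP r3; apply/eqP.
    by have /(cube_root ltr01 r0) := r3; rewrite powR1.
  have r2 : r ^+ 2 != 0 by rewrite expf_neq0.
  split; apply: (mulfI c0); rewrite mulr0; apply: (mulIf r2); rewrite mul0r.
  - match type of e14 with ?A = ?B => transitivity (r ^+ 4 * (B - A)) end.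
      by field.
    by rewrite e14 subrr mulr0.
  - match type of e24 with ?A = ?B => transitivity (r ^+ 4 * (B - A)) end.
      by field.
    by rewrite e24 subrr mulr0.
  match type of e34 with ?A = ?B => transitivity (r ^+ 4 * (A - B)) end.
    by field.
  by rewrite e34 subrr mulr0.
have h0E : q0 h ^+ 2 = 1 - q1 h ^+ 2 - q2 h ^+ 2 - q3 h ^+ 2 by rewrite -hS; ring.
move=> cond; apply: (@form_of_coefP _ _ _ keys5); [by vm_compute|by vm_compute|].
apply: mmemP; rewrite /keys5 /dpsi_list /tau1_list /psi_list !skewE; cbv [map foldr].
case: cond => [->|[e3 e0 e1]].
  rewrite /rot_entry; do 9 (split; [by lcbv; field: h0E|]); exact: I.
have z1 : 4 * q2 h * q3 h = 0 by rewrite -mulrA e3 mulr0.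
have z2 : 4 * q0 h * q2 h = 0 by rewrite -mulrA e0 mulr0.
have z3 : 4 * q1 h * q2 h = 0 by rewrite -mulrA e1 mulr0.
rewrite z1 z2 z3; do 9 (split; [by lcbv; field|]); exact: I.
Qed.

Lemma nearly_parallel_phi r h : 0 < r -> S3 h ->
  nearly_parallel (phi r h) <->
    (r = 2 `^ 3^-1 /\ equator h) \/ (r = (2 / 5) `^ 3^-1 /\ poles h).
Proof.
move=> r0 hS; have rn : r != 0 by rewrite gt_eqF.
have r2 : r ^+ 2 != 0 by rewrite expf_neq0.
have h0E : q0 h ^+ 2 = 1 - q1 h ^+ 2 - q2 h ^+ 2 - q3 h ^+ 2 by rewrite -hS; ring.
have c1 : 0 < (2 : R) by [].
have c2 : 0 < (2 / 5 : R) by rewrite divr_gt0.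
rewrite (cube_root c1 r0) (cube_root c2 r0).
rewrite /nearly_parallel (psi_phi r0 hS) (dext_phi r hS) (tau0_phi r0 hS).
set t := - (4 / 7) * _; rewrite -form_of_scale; split=> [[e /eqP tn]|].
  have wl : wf (lscale t (psi_list r (rot_entry h))) by vm_compute.
  have := @form_eq_coef _ (dphi_list r (rot_entry h)) _ keys4 isT isT wl e.
  rewrite /keys4 /dphi_list /psi_list; cbv [map foldr]; lcbv; rewrite !addr0.
  case=> e4567 [_ [_ [e1356 [_ [e1256 [_ [e2357 [_ [_ [_ [e1257 [_ [_ [e2345 [_ [e1345 _]]]]]]]]]]]]]]]].
  (* In each pair of equations used below the coefficients of d phi cancel, leaving t r times a skew
     quantity equal to 0: the coclosed condition. *)
  have tr : t * r != 0 by rewrite mulf_neq0.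
  have s1 : skew1 (rot_entry h) = 0.
    apply: (mulfI tr); rewrite mulr0 /skew1.
    match type of e1257 with ?A = ?B => match type of e1345 with ?C = ?D =>
      transitivity (- (B + D)); [by ring|by rewrite -e1257 -e1345; ring] end end.
  have s2 : skew2 (rot_entry h) = 0.
    apply: (mulfI tr); rewrite mulr0 /skew2.
    match type of e1256 with ?A = ?B => match type of e2345 with ?C = ?D =>
      transitivity (D - B); [by ring|by rewrite -e1256 -e2345; ring] end end.
  have s3 : skew3 (rot_entry h) = 0.
    apply: (mulfI tr); rewrite mulr0 /skew3.
    match type of e1356 with ?A = ?B => match type of e2357 with ?C = ?D =>
      transitivity (- (B + D)); [by ring|by rewrite -e1356 -e2357; ring] end end.
  have cl : coclosed_eqs h.
    have n4 : (4 : R) != 0 by rewrite pnatr_eq0.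
    move: s1 s2 s3; rewrite !skewE => s1 s2 s3; split; apply: (mulfI n4); rewrite mulr0 mulrA //.
    by rewrite -[LHS]opprK s2 oppr0.
  move: e4567; rewrite (_ : rot_entry h 0%N 0%N - rot_entry h 1%N 1%N + rot_entry h 2%N 2%N = 1 - 4 * q2 h ^+ 2); last first.
    by rewrite /rot_entry; ring: h0E.
  rewrite /t => e4567; have [eq|[q22 e0 e1 e3]] := coclosed_cases hS cl.
    left; split => //; rewrite eq in e4567.
    (* For T = 1 the difference of the two sides is -10/7 + 20/(7 r^3); the factor normalises it to
       r^3 - 2. *)
    match type of e4567 with ?A = ?B => transitivity (2 + (- (7 / 10) * r ^+ 3) * (A - B)) end.
      by field.
    by rewrite e4567 subrr mulr0 addr0.
  right; split; last first.
    case/(coclosed_eqsP hS): cl => // -[_ eq].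
    by move: q22 => /eqP; rewrite eq expr0n /= eq_sym oner_eq0.
  rewrite q22 in e4567.
  (* For T = -3 the difference is 30/7 - 12/(7 r^3), normalised to r^3 - 2/5. *)
  match type of e4567 with ?A = ?B => transitivity (2 / 5 + (7 / 30 * r ^+ 3) * (A - B)) end.
    by field.
  by rewrite e4567 subrr mulr0 addr0.
have r0' : r ^+ 2 != 0 by [].
case=> [[r3 [_ eq]]|[r3 hp]].
  have tE : t = - (2 * r ^+ 2).
    have ri : r^-1 = r ^+ 2 / 2 by rewrite -[X in _ / X]r3; field.
    by rewrite /t eq ri; field.
  split; last first.
    by apply/eqP; rewrite tE oppr_eq0 mulf_neq0 ?pnatr_eq0.
  rewrite tE; apply: (@form_of_coefP _ _ _ keys4); [by vm_compute|by vm_compute|].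
  apply: mmemP; rewrite /keys4 /dphi_list /psi_list /rot_entry eq; cbv [map foldr].
  have h0E' : q0 h ^+ 2 = 1 - q1 h ^+ 2 - q3 h ^+ 2 by rewrite h0E eq; ring.
  by do 19 (split; [by lcbv; field: h0E' r3|]).
have [q22 e0 e1 e3] : [/\ q2 h ^+ 2 = 1, q0 h = 0, q1 h = 0 & q3 h = 0].
  by case: hp => ->; rewrite /qj !qE; split; ring.
have tE : t = 6 * r ^+ 2.
  have ri : r^-1 = r ^+ 2 / (2 / 5) by rewrite -r3; field.
  by rewrite /t q22 ri; field.
split; last first.
  by apply/eqP; rewrite tE mulf_neq0 ?pnatr_eq0.
rewrite tE; apply: (@form_of_coefP _ _ _ keys4); [by vm_compute|by vm_compute|].
apply: mmemP; rewrite /keys4 /dphi_list /psi_list /rot_entry e0 e1 e3 q22; cbv [map foldr].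
by do 19 (split; [by lcbv; first [field | lra]|]).
Qed.
End TorsionRegimes.

(** * Unit quaternions and rotations *)

Section Rotations.
Variable R : realType.
Implicit Types (r : R) (B : 'M[R]_3) (h k : quat R).

(** The hypotheses say h h^T = k k^T, so k = k k^T k = h h^T k = s h with s the inner product of h
    and k; comparing norms gives s^2 = 1. *)
Lemma eq_quat_sign h k : S3 h -> S3 k ->
  [/\ q0 h * q0 h = q0 k * q0 k, q1 h * q1 h = q1 k * q1 k, q2 h * q2 h = q2 k * q2 k
    & q3 h * q3 h = q3 k * q3 k] ->
  [/\ q0 h * q1 h = q0 k * q1 k, q0 h * q2 h = q0 k * q2 k & q0 h * q3 h = q0 k * q3 k] ->
  [/\ q1 h * q2 h = q1 k * q2 k, q1 h * q3 h = q1 k * q3 k & q2 h * q3 h = q2 k * q3 k] ->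
  k = h \/ k = - h.
Proof.
move=> hS kS [e00 e11 e22 e33] [e01 e02 e03] [e12 e13 e23].
pose s := q0 h * q0 k + q1 h * q1 k + q2 h * q2 k + q3 h * q3 k.
have hN : q0 h * q0 h + q1 h * q1 h + q2 h * q2 h + q3 h * q3 h = 1 by rewrite -!expr2.
have k0 : q0 k = s * q0 h.
  rewrite -[LHS]mul1r -hN e00 e11 e22 e33.
  transitivity (q0 k * (q0 k * q0 k) + q1 k * (q0 k * q1 k) + q2 k * (q0 k * q2 k)
    + q3 k * (q0 k * q3 k)); first by ring.
  by rewrite -e00 -e01 -e02 -e03 /s; ring.
have k1 : q1 k = s * q1 h.
  rewrite -[LHS]mul1r -hN e00 e11 e22 e33.
  transitivity (q0 k * (q0 k * q1 k) + q1 k * (q1 k * q1 k) + q2 k * (q1 k * q2 k)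
    + q3 k * (q1 k * q3 k)); first by ring.
  by rewrite -e01 -e11 -e12 -e13 /s; ring.
have k2 : q2 k = s * q2 h.
  rewrite -[LHS]mul1r -hN e00 e11 e22 e33.
  transitivity (q0 k * (q0 k * q2 k) + q1 k * (q1 k * q2 k) + q2 k * (q2 k * q2 k)
    + q3 k * (q2 k * q3 k)); first by ring.
  by rewrite -e02 -e12 -e22 -e23 /s; ring.
have k3 : q3 k = s * q3 h.
  rewrite -[LHS]mul1r -hN e00 e11 e22 e33.
  transitivity (q0 k * (q0 k * q3 k) + q1 k * (q1 k * q3 k) + q2 k * (q2 k * q3 k)
    + q3 k * (q3 k * q3 k)); first by ring.
  by rewrite -e03 -e13 -e23 -e33 /s; ring.
have : s ^+ 2 == 1.
  by apply/eqP; rewrite -[RHS]kS k0 k1 k2 k3 -[LHS]mulr1 -hS; ring.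
clearbody s; rewrite sqrf_eq1 => /orP[] /eqP es; [left|right]; apply: quatP;
  by rewrite ?qE ?k0 ?k1 ?k2 ?k3 es ?mul1r ?mulN1r.
Qed.

Lemma rot_entry_inj h k : S3 h -> S3 k ->
  (forall i j : nat, (i < 3)%N -> (j < 3)%N -> rot_entry h i j = rot_entry k i j) -> k = h \/ k = - h.
Proof.
move=> hS kS e; have hN : q0 h ^+ 2 + q1 h ^+ 2 + q2 h ^+ 2 + q3 h ^+ 2 = 1 := hS.
have kN : q0 k ^+ 2 + q1 k ^+ 2 + q2 k ^+ 2 + q3 k ^+ 2 = 1 := kS.
have e00 := e 0%N 0%N isT isT; have e01 := e 0%N 1%N isT isT; have e02 := e 0%N 2%N isT isT.
have e10 := e 1%N 0%N isT isT; have e11 := e 1%N 1%N isT isT; have e12 := e 1%N 2%N isT isT.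
have e20 := e 2%N 0%N isT isT; have e21 := e 2%N 1%N isT isT; have e22 := e 2%N 2%N isT isT.
rewrite /rot_entry in e00 e01 e02 e10 e11 e12 e20 e21 e22.
by apply: eq_quat_sign => //; split; lra.
Qed.

Lemma rot_entry_opp h i j : rot_entry (- h) i j = rot_entry h i j.
Proof. by case: i => [|[|i]]; case: j => [|[|j]]; rewrite /rot_entry !qE; ring. Qed.

Lemma Upsilon_eq h B : (forall i j : nat, (i < 3)%N -> (j < 3)%N -> rot_entry h i j = mx_entry B i j) ->
  B = Upsilon h.
Proof.
move=> e; apply/matrixP => i j; rewrite -(inord_val i) -(inord_val j).
by rewrite -[RHS]/(mx_entry (Upsilon h) i j) Upsilon_entry // e.
Qed.

Lemma Upsilon_mul h k : Upsilon (h * k) = Upsilon h *m Upsilon k.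
Proof.
symmetry; apply: Upsilon_eq => i j lti ltj; rewrite /mx_entry mxE sum_ord3.
rewrite -[X in _ = X]/(mx_entry (Upsilon h) i 0%N * mx_entry (Upsilon k) 0%N j +
  (mx_entry (Upsilon h) i 1%N * mx_entry (Upsilon k) 1%N j + mx_entry (Upsilon h) i 2%N * mx_entry (Upsilon k) 2%N j)).
rewrite !Upsilon_entry //; case: i lti => [|[|[|i]]] // _; case: j ltj => [|[|[|j]]] // _;
  by rewrite /rot_entry !qE; ring.
Qed.

Lemma S3_mul h k : S3 h -> S3 k -> S3 (h * k).
Proof.
rewrite /S3 /= => hS kS; rewrite !qE -[RHS]mulr1 -{1}hS -kS; ring.
Qed.

(** The cofactor matrix, with cyclically ordered indices absorbing the signs. *)
Definition ncof (b : nat -> nat -> R) (i j : nat) : R :=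
  let c p q s t := b p q * b s t - b p t * b s q in
  match i, j with
  | 0, 0 => c 1%N 1%N 2%N 2%N | 0, 1 => c 1%N 2%N 2%N 0%N | 0, _ => c 1%N 0%N 2%N 1%N
  | 1, 0 => c 2%N 1%N 0%N 2%N | 1, 1 => c 2%N 2%N 0%N 0%N | 1, _ => c 2%N 0%N 0%N 1%N
  | _, 0 => c 0%N 1%N 1%N 2%N | _, 1 => c 0%N 2%N 1%N 0%N | _, _ => c 0%N 0%N 1%N 1%N
  end.

(** The cofactor matrix C satisfies C^T B = det B = 1, so C^T is the inverse of B, which is B^T. *)
Lemma rotation_cofactor B i j : rotation B -> (i < 3)%N -> (j < 3)%N -> mx_entry B i j = ncof (mx_entry B) i j.
Proof.
case=> BB dB lti ltj; pose C : 'M[R]_3 := \matrix_(p, q) ncof (mx_entry B) p q.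
have CE p q : (p < 3)%N -> (q < 3)%N -> C (inord p) (inord q) = ncof (mx_entry B) p q.
  by move=> ltp ltq; rewrite mxE !inordK.
suff -> : ncof (mx_entry B) i j = mx_entry C i j.
  suff -> : C = B by [].
  have CB : C^T *m B = 1%:M.
    apply/matrixP => p q; rewrite -(inord_val p) -(inord_val q) mxE sum_ord3 !(mxE, inordK) //.
    rewrite -[X in X = _]/(ncof (mx_entry B) 0%N p * mx_entry B 0%N q
      + (ncof (mx_entry B) 1%N p * mx_entry B 1%N q
      + ncof (mx_entry B) 2%N p * mx_entry B 2%N q)).
    have -> : (inord p == inord q :> 'I_3) = (p == q :> nat) by rewrite !inord_val.
    rewrite -dB det3 /ndet; move: (mx_entry B) => b.
    by case: p => [[|[|[|p]]] lt_p] //; case: q => [[|[|[|q]]] lt_q] //;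
      rewrite /ncof /= ?mulr0n ?mulr1n; ring.
  have BBt : B *m B^T = 1%:M by apply: mulmx1C.
  by apply: trmx_inj; rewrite -[LHS]mulmx1 -BBt mulmxA CB mul1mx.
by rewrite /mx_entry CE.
Qed.

Lemma rotation_orthogonal B i j : rotation B -> (i < 3)%N -> (j < 3)%N -> let b := mx_entry B in
  b 0%N i * b 0%N j + b 1%N i * b 1%N j + b 2%N i * b 2%N j = (i == j)%:R /\
  b i 0%N * b j 0%N + b i 1%N * b j 1%N + b i 2%N * b j 2%N = (i == j)%:R.
Proof.
case=> BB dB lti ltj b; have BBt : B *m B^T = 1%:M by apply: mulmx1C.
have e : ((inord i : 'I_3) == inord j) = (i == j) by rewrite -val_eqE /= !inordK.
split; first by rewrite -tr_mul3 // BB mxE e.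
have := tr_mul3 B^T lti ltj; rewrite trmxK BBt mxE e => ->.
by rewrite /b /mx_entry !mxE.
Qed.

(* If B = Upsilon h then 4 (h0)^2 = 1 + tr B, and the antisymmetric part of B
   gives 4 h0 h1, 4 h0 h2 and 4 h0 h3. *)
Lemma rotation_Upsilon_pos B : rotation B -> let b := mx_entry B in
  0 < 1 + b 0%N 0%N + b 1%N 1%N + b 2%N 2%N -> exists2 h, S3 h & B = Upsilon h.
Proof.
move=> sB b; set t := 1 + _ + _ + _ => t0.
have C i j := @rotation_cofactor B i j sB; have O i j := @rotation_orthogonal B i j sB.
have := (C 0%N 0%N isT isT, C 0%N 1%N isT isT, C 0%N 2%N isT isT, C 1%N 0%N isT isT, C 1%N 1%N isT isT,
  C 1%N 2%N isT isT, C 2%N 0%N isT isT, C 2%N 1%N isT isT, C 2%N 2%N isT isT).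
rewrite /ncof -/b => -[[[[[[[[c00 c01] c02] c10] c11] c12] c20] c21] c22].
have [r00 l00] := O 0%N 0%N isT isT; have [r11 l11] := O 1%N 1%N isT isT; have [r22 l22] := O 2%N 2%N isT isT.
have [r01 l01] := O 0%N 1%N isT isT; have [r02 l02] := O 0%N 2%N isT isT; have [r12 l12] := O 1%N 2%N isT isT.
rewrite -/b /= ?mulr1n ?mulr0n in r00 l00 r11 l11 r22 l22 r01 l01 r02 l02 r12 l12.
clear C O.
(* For the quaternion to be built, these six identities read (4 h0 h_a)(4 h0 h_b) = (4 h0^2)(4 h_a
   h_b). *)
have i1 : (b 2%N 1%N - b 1%N 2%N) ^+ 2 = t * (1 + b 0%N 0%N - b 1%N 1%N - b 2%N 2%N) by rewrite /t; lra.
have i2 : (b 0%N 2%N - b 2%N 0%N) ^+ 2 = t * (1 - b 0%N 0%N + b 1%N 1%N - b 2%N 2%N) by rewrite /t; lra.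
have i3 : (b 1%N 0%N - b 0%N 1%N) ^+ 2 = t * (1 - b 0%N 0%N - b 1%N 1%N + b 2%N 2%N) by rewrite /t; lra.
have i12 : (b 2%N 1%N - b 1%N 2%N) * (b 0%N 2%N - b 2%N 0%N) = t * (b 0%N 1%N + b 1%N 0%N) by rewrite /t; lra.
have i13 : (b 2%N 1%N - b 1%N 2%N) * (b 1%N 0%N - b 0%N 1%N) = t * (b 0%N 2%N + b 2%N 0%N) by rewrite /t; lra.
have i23 : (b 0%N 2%N - b 2%N 0%N) * (b 1%N 0%N - b 0%N 1%N) = t * (b 1%N 2%N + b 2%N 1%N) by rewrite /t; lra.
pose c := Num.sqrt t; have c0 : c != 0 by rewrite gt_eqF // sqrtr_gt0.
have cc : c ^+ 2 = t by rewrite sqr_sqrtr // ltW.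
pose h1 := (b 2%N 1%N - b 1%N 2%N) / (2 * c); pose h2 := (b 0%N 2%N - b 2%N 0%N) / (2 * c).
pose h3 := (b 1%N 0%N - b 0%N 1%N) / (2 * c); pose h0 := c / 2.
have e00 : h0 ^+ 2 = t / 4 by rewrite -cc /h0; field.
have e01 : h0 * h1 = (b 2%N 1%N - b 1%N 2%N) / 4 by rewrite /h0 /h1; field.
have e02 : h0 * h2 = (b 0%N 2%N - b 2%N 0%N) / 4 by rewrite /h0 /h2; field.
have e03 : h0 * h3 = (b 1%N 0%N - b 0%N 1%N) / 4 by rewrite /h0 /h3; field.
have aux x y z : x * y = t * z -> (x / (2 * c)) * (y / (2 * c)) = z / 4.
  by move=> e; transitivity (x * y / (4 * c ^+ 2)); [field|rewrite e -cc; field].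
have e11 : h1 ^+ 2 = (1 + b 0%N 0%N - b 1%N 1%N - b 2%N 2%N) / 4 by rewrite expr2; apply: aux; rewrite -expr2.
have e22 : h2 ^+ 2 = (1 - b 0%N 0%N + b 1%N 1%N - b 2%N 2%N) / 4 by rewrite expr2; apply: aux; rewrite -expr2.
have e33 : h3 ^+ 2 = (1 - b 0%N 0%N - b 1%N 1%N + b 2%N 2%N) / 4 by rewrite expr2; apply: aux; rewrite -expr2.
have e12 : h1 * h2 = (b 0%N 1%N + b 1%N 0%N) / 4 by exact: aux.
have e13 : h1 * h3 = (b 0%N 2%N + b 2%N 0%N) / 4 by exact: aux.
have e23 : h2 * h3 = (b 1%N 2%N + b 2%N 1%N) / 4 by exact: aux.
exists (qmk h0 h1 h2 h3); first by rewrite /S3 /= !qmkE e00 e11 e22 e33 /t; field.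
apply: Upsilon_eq => i j lti ltj; rewrite -/b.
case: i lti => [|[|[|i]]] // _; case: j ltj => [|[|[|j]]] // _;
  by rewrite /rot_entry !qmkE ?e00 ?e01 ?e02 ?e03 ?e11 ?e22 ?e33 ?e12 ?e13 ?e23 /t; field.
Qed.

Lemma S3_unit (h : quat R) : h = qi R \/ h = qj R \/ h = qk R -> S3 h.
Proof. by case=> [->|[->|->]]; rewrite /S3 /qi /qj /qk /= !qE; ring. Qed.

Lemma rotation_mul B B' : rotation B -> rotation B' -> rotation (B *m B').
Proof.
move=> [BB dB] [BB' dB']; split; last by rewrite det_mulmx dB dB' mulr1.
by rewrite trmx_mul mulmxA -(mulmxA _ _ B) BB mulmx1 BB'.
Qed.

(* The traces of B, B Upsilon(i), B Upsilon(j), B Upsilon(k) add up to 0, so one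
   of the four exceeds -1. *)
Lemma rotation_Upsilon B : rotation B -> exists2 h, S3 h & B = Upsilon h.
Proof.
move=> sB; have := @rotation_Upsilon_pos B sB.
(* If B Upsilon(u) = Upsilon h, multiplying by Upsilon(u) gives B = Upsilon(h u), because Upsilon(u
   u) = Upsilon(-1) = 1. *)
have red (u : quat R) : S3 u -> u * u = -1 ->
    0 < 1 + mx_entry (B *m Upsilon u) 0%N 0%N + mx_entry (B *m Upsilon u) 1%N 1%N + mx_entry (B *m Upsilon u) 2%N 2%N ->
    exists2 h, S3 h & B = Upsilon h.
  move=> uS uu /(rotation_Upsilon_pos (rotation_mul sB (Upsilon_rotation uS))) [h hS e].
  exists (h * u); first exact: S3_mul.
  rewrite Upsilon_mul -e -mulmxA -Upsilon_mul uu.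
  suff -> : Upsilon (-1 : quat R) = 1%:M by rewrite mulmx1.
  symmetry; apply: Upsilon_eq => i j lti ltj; rewrite /mx_entry mxE -val_eqE /= !inordK //.
  case: i lti => [|[|[|i]]] // _; case: j ltj => [|[|[|j]]] // _;
    by rewrite /rot_entry !qE /= ?mulr1n ?mulr0n; ring.
have mulE (u : quat R) i : (i < 3)%N -> mx_entry (B *m Upsilon u) i i =
   mx_entry B i 0%N * rot_entry u 0%N i + (mx_entry B i 1%N * rot_entry u 1%N i + mx_entry B i 2%N * rot_entry u 2%N i).
  move=> lti; rewrite {1}/mx_entry mxE sum_ord3.
  by rewrite -!(Upsilon_entry u).
have := red (qi R); have := red (qj R); have := red (qk R); rewrite !mulE // /rot_entry /qi /qj /qk !qE.
move: (mx_entry B) => b hk hj hi h1.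
have sq (u : quat R) : q0 u = 0 -> S3 u -> u * u = -1.
  move=> u0 uS; have uN : q0 u ^+ 2 + q1 u ^+ 2 + q2 u ^+ 2 + q3 u ^+ 2 = 1 := uS.
  by apply: quatP; rewrite !qE u0 -?uN ?u0; ring.
have [p1|n1] := ltP 0 (1 + b 0%N 0%N + b 1%N 1%N + b 2%N 2%N); first exact: h1.
have [p2|n2] := ltP 0 (1 + b 0%N 0%N - b 1%N 1%N - b 2%N 2%N).
  apply: hi; [by apply: S3_unit; left|apply: sq; [by rewrite qE|by apply: S3_unit; left]|lra].
have [p3|n3] := ltP 0 (1 - b 0%N 0%N + b 1%N 1%N - b 2%N 2%N).
  by apply: hj; [apply: S3_unit; right; left|apply: sq; [rewrite qE|apply: S3_unit; right; left]|lra].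
by apply: hk; [apply: S3_unit; right; right|apply: sq; [rewrite qE|apply: S3_unit; right; right]|lra].
Qed.

Lemma calB_phi r f : calB r f <-> exists2 h, S3 h & phi r h = f.
Proof.
rewrite calB_three_form; split=> [[B sB ->]|[h hS <-]].
  by have [h hS ->] := rotation_Upsilon sB; exists h => //; rewrite phi_three.
by exists (Upsilon h); [exact: Upsilon_rotation|rewrite phi_three].
Qed.

(** Vertical entries compare r^2 with lam, horizontal ones 1/r with 1/2, the square of [rsqrt2]; the
    two ratios agree when r^3 = 2 lam. *)
Lemma hopf_g r lam : 0 < r -> 0 < lam -> r ^+ 3 = 2 * lam -> homothetic (g_ r) (hopf_metric lam).
Proof.
move=> r0 l0 rl; have rn : r != 0 by rewrite gt_eqF.
have ln : lam != 0 by rewrite gt_eqF.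
have lE : lam = r ^+ 3 / 2 by rewrite rl; field.
exists (r ^+ 2 / lam); first by rewrite divr_gt0 ?exprn_gt0.
apply/matrixP => m n; rewrite !mxE.
case: m => [[|[|[|[|[|[|[|m]]]]]]] lt_m] //; case: n => [[|[|[|[|[|[|[|n]]]]]]] lt_n] //;
  rewrite /pbasis /= !mx2_entries /qi /qj /qk /qone -/(rsqrt2 R) !qE ?mulr1n ?mulr0n;
  first [by field | by transitivity (r ^+ 2 / lam * (rsqrt2 R * rsqrt2 R)); [rewrite rsqrt2_sqr lE|]; field].
Qed.
End Rotations.

Import numFieldNormedType.Exports.

(** * A smooth extension of phi to R^4 *)

Section PolynomialExtension.
Variable R : realType.
Implicit Types (r : R) (h k : quat R) (u w : 'rV[R]_4 -> R).

Lemma derive_quadratic u (h v : 'rV[R]_4) (a b : R) :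
  (forall t : R, u (t *: v + h) = u h + t * a + t ^+ 2 * b) -> 'D_v u h = a.
Proof.
move=> e; rewrite /derive; apply: cvg_lim => //.
have : ((fun t : R => a + t * b) @ (0 : R)^' --> a)%classic.
  apply: cvg_trans; first apply: cvg_app; first exact: cvg_within.
  rewrite -[X in (_ --> X)%classic]addr0 -[X in _ + X](mul0r b).
  apply: cvgD; first exact: cvg_cst.
  by apply: cvgM; [exact: cvg_id|exact: cvg_cst].
apply: cvg_trans; apply: near_eq_cvg; near=> t.
have t0 : t != 0 by near: t; exact: nbhs_dnbhs_neq.
rewrite /= e -[RHS]/(t^-1 * (u h + t * a + t ^+ 2 * b - u h)).
by field.
Unshelve. all: by end_near. Qed.

(** Polynomial functions: a class of differentiable functions stable under directional derivatives,
    so that [Ck] follows for all n by induction. *)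
Inductive polyf : ('rV[R]_4 -> R) -> Prop :=
| polyf_cst c : polyf (fun _ => c)
| polyf_coord i : polyf (fun x => x ord0 i)
| polyf_add u w : polyf u -> polyf w -> polyf (fun x => u x + w x)
| polyf_mul u w : polyf u -> polyf w -> polyf (fun x => u x * w x).

Lemma polyf_differentiable u : polyf u -> forall x, differentiable u x.
Proof.
elim=> [c|i|{}u w _ du _ dw|{}u w _ du _ dw] x.
- exact: differentiable_cst.
- exact: differentiable_coord.
- exact: (differentiableD (du x) (dw x)).
exact: (differentiableM (du x) (dw x)).
Qed.

Lemma polyf_ext u w : polyf u -> (forall x, w x = u x) -> polyf w.
Proof. by move=> pu e; have -> : w = u by apply/funext. Qed.

Lemma polyf_derive u : polyf u -> forall v, polyf (fun x => 'D_v u x).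
Proof.
have dbl u' x v : polyf u' -> derivable u' x v.
  by move=> /polyf_differentiable/(_ x) /diff_derivable.
elim=> [c|i|{}u w pu du pw dw|{}u w pu du pw dw] v.
- apply: (polyf_ext (polyf_cst 0)) => x; exact: derive_cst.
- apply: (polyf_ext (polyf_cst (v ord0 i))) => x; apply: (@derive_quadratic _ _ _ _ 0) => t.
  by rewrite !mxE mulr0 addr0 addrC.
- apply: (polyf_ext (polyf_add (du v) (dw v))) => x; apply: deriveD; exact: dbl.
apply: (polyf_ext (polyf_add (polyf_mul pu (dw v)) (polyf_mul pw (du v)))) => x.
by apply: deriveM; apply: dbl.
Qed.

Lemma polyf_Ck n u : polyf u -> Ck n u.
Proof.
elim: n u => [|n IH] u pu /=.
  by move=> x; apply: differentiable_continuous; apply: polyf_differentiable.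
by split=> [x|v]; [exact: polyf_differentiable|apply: IH; exact: polyf_derive].
Qed.

Lemma polyf_sub u w : polyf u -> polyf w -> polyf (fun x => u x - w x).
Proof.
move=> pu pw; apply: (polyf_ext (polyf_add pu (polyf_mul (polyf_cst (-1)) pw))) => x.
by rewrite mulN1r.
Qed.

Lemma polyf_rot_entry i j : polyf (fun x : quat R => rot_entry x i j).
Proof.
have c (n : nat) : polyf (fun x : 'rV[R]_4 => x ord0 (inord n)) by exact: polyf_coord.
have [c0 c1 c2 c3] : [/\ polyf (@q0 R), polyf (@q1 R), polyf (@q2 R) & polyf (@q3 R)].
  by split; apply: c.
case: i => [|[|i]]; case: j => [|[|j]]; rewrite /rot_entry /=;
  do ?[exact: polyf_cst|exact: c0|exact: c1|exact: c2|exact: c3|apply: polyf_sub|apply: polyf_add|apply: polyf_mul].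
Qed.

(** Off the sphere [phi] involves a matrix inverse; the extension keeps instead the polynomial
    formula that holds on S^3. *)
Definition phi_ext r (x : 'rV[R]_4) : extform R := form_of (three_list (r ^+ 3) (@rot_entry R x)).

Lemma phi_ext_smooth r : smooth (phi_ext r).
Proof.
move=> S n; apply: polyf_Ck; rewrite /phi_ext /three_list.
have pm u m : polyf u -> polyf (fun x => u x * mono R m S).
  by move=> pu; apply: polyf_mul => //; exact: polyf_cst.
have pn i j : polyf (fun x : quat R => - rot_entry x i j).
  by apply: (polyf_ext (polyf_sub (polyf_cst 0) (polyf_rot_entry i j))) => x; rewrite sub0r.
have pf (l : quat R -> seq (R * seq bool)) (a : quat R -> R) (m : seq bool) :
    polyf a -> polyf (fun x => form_of (l x) S) -> polyf (fun x => form_of ((a x, m) :: l x) S).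
  by move=> pa pl; apply: (polyf_ext (polyf_add (pm _ m pa) pl)) => x; rewrite form_of_cons !ffunE.
do 19 (apply: (pf _ _ _); [by [exact: polyf_cst|exact: polyf_rot_entry|exact: pn]|]).
by apply: (polyf_ext (polyf_cst 0)) => x; rewrite form_of_nil ffunE.
Qed.
End PolynomialExtension.

(** * The embedding of RP^3 *)

Section ProjectiveEmbedding.
Variable R : realType.
Implicit Types (r : R) (h k : quat R).

(* e^{(j+1) 4 (7-i)}, on which the coefficient of [phi] is [Upsilon h i j] *)
Definition entry_mask (i j : nat) : seq bool := idx_mask [:: j.+1; 4; 7 - i]%N.

Lemma phi_ext_coef r (x : 'rV[R]_4) i j : (i < 3)%N -> (j < 3)%N ->
  phi_ext r x (mset (entry_mask i j)) = rot_entry (x : quat R) i j.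
Proof.
move=> lti ltj; rewrite /phi_ext form_of_coef //; last first.
  by case: i lti => [|[|[|i]]] //; case: j ltj => [|[|[|j]]].
case: i lti => [|[|[|i]]] // _; case: j ltj => [|[|[|j]]] // _;
  rewrite /three_list /entry_mask ?subn0 ?subSS ?subn0; lcbv; by rewrite addr0.
Qed.

(** Every entry is a quadratic form in h, so its derivative is the polarisation. *)
Lemma derive_rot_entry h (v : 'rV[R]_4) i j :
  'D_v (fun x : 'rV[R]_4 => rot_entry (x : quat R) i j) h =
  rot_entry (v + h : quat R) i j - rot_entry h i j - rot_entry (v : quat R) i j.
Proof.
apply: (@derive_quadratic _ _ _ _ _ (rot_entry (v : quat R) i j)) => t.
by case: i => [|[|i]]; case: j => [|[|j]]; rewrite /rot_entry /q0 /q1 /q2 /q3 !mxE; ring.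
Qed.

Lemma sum_ord4 (V : nmodType) (F : 'I_4 -> V) :
  \sum_(i < 4) F i = F (inord 0) + (F (inord 1) + (F (inord 2) + F (inord 3))).
Proof.
transitivity (\sum_(0 <= n < 4) F (inord n)).
  by rewrite big_mkord; apply: eq_bigr => i _; rewrite inord_val.
by rewrite /index_iota /= !big_cons big_nil addr0.
Qed.

(** Nine derivatives and the tangency condition amount to h v^T + v h^T = 0; applying this matrix to
    h gives |h|^2 v = 0. *)
Lemma phi_ext_immersion r h (v : 'rV[R]_4) : S3 h -> \sum_(n < 4) h ord0 n * v ord0 n = 0 ->
  (forall S, 'D_v (fun x => phi_ext r x S : R) h = 0) -> v = 0.
Proof.
move=> hS; rewrite sum_ord4 => hv D.
have {}D i j : (i < 3)%N -> (j < 3)%N ->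
    rot_entry (v + h : quat R) i j - rot_entry h i j - rot_entry (v : quat R) i j = 0.
  move=> lti ltj; rewrite -derive_rot_entry -(D (mset (entry_mask i j))).
  by congr ('D_v _ h); apply/funext => x; rewrite phi_ext_coef.
have hN : q0 h ^+ 2 + q1 h ^+ 2 + q2 h ^+ 2 + q3 h ^+ 2 = 1 := hS.
have := (D 0%N 0%N isT isT, D 0%N 1%N isT isT, D 0%N 2%N isT isT, D 1%N 0%N isT isT,
  D 1%N 1%N isT isT, D 1%N 2%N isT isT, D 2%N 0%N isT isT, D 2%N 1%N isT isT, D 2%N 2%N isT isT).
clear D; move: hv hN; rewrite /rot_entry /q0 /q1 /q2 /q3 !mxE.
set h0 := h _ _; set v0 := v _ _; set h1 := h _ (inord 1); set v1 := v _ (inord 1).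
set h2 := h _ (inord 2); set v2 := v _ (inord 2); set h3 := h _ (inord 3); set v3 := v _ (inord 3).
move=> hv hN [[[[[[[[d00 d01] d02] d10] d11] d12] d20] d21] d22].
have e0 : h0 * v0 = 0 by lra.
have e1 : h1 * v1 = 0 by lra.
have e2 : h2 * v2 = 0 by lra.
have e3 : h3 * v3 = 0 by lra.
have e01 : h0 * v1 + h1 * v0 = 0 by lra.
have e02 : h0 * v2 + h2 * v0 = 0 by lra.
have e03 : h0 * v3 + h3 * v0 = 0 by lra.
have e12 : h1 * v2 + h2 * v1 = 0 by lra.
have e13 : h1 * v3 + h3 * v1 = 0 by lra.
have e23 : h2 * v3 + h3 * v2 = 0 by lra.
have z0 : v0 = 0.
  rewrite -[LHS]mul1r -hN; transitivity (h0 * (h0 * v0) + h1 * (h0 * v1 + h1 * v0)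
    + h2 * (h0 * v2 + h2 * v0) + h3 * (h0 * v3 + h3 * v0) - h0 * (h1 * v1 + h2 * v2 + h3 * v3)).
    by ring.
  by rewrite e01 e02 e03 e0 e1 e2 e3; ring.
have z1 : v1 = 0.
  rewrite -[LHS]mul1r -hN; transitivity (h0 * (h0 * v1 + h1 * v0) + h1 * (h1 * v1)
    + h2 * (h1 * v2 + h2 * v1) + h3 * (h1 * v3 + h3 * v1) - h1 * (h0 * v0 + h2 * v2 + h3 * v3)).
    by ring.
  by rewrite e01 e12 e13 e0 e1 e2 e3; ring.
have z2 : v2 = 0.
  rewrite -[LHS]mul1r -hN; transitivity (h0 * (h0 * v2 + h2 * v0) + h1 * (h1 * v2 + h2 * v1)
    + h2 * (h2 * v2) + h3 * (h2 * v3 + h3 * v2) - h2 * (h0 * v0 + h1 * v1 + h3 * v3)).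
    by ring.
  by rewrite e02 e12 e23 e0 e1 e2 e3; ring.
have z3 : v3 = 0.
  rewrite -[LHS]mul1r -hN; transitivity (h0 * (h0 * v3 + h3 * v0) + h1 * (h1 * v3 + h3 * v1)
    + h2 * (h2 * v3 + h3 * v2) + h3 * (h3 * v3) - h3 * (h0 * v0 + h1 * v1 + h2 * v2)).
    by ring.
  by rewrite e03 e13 e23 e0 e1 e2 e3; ring.
by apply: (@quatP R (v : quat R) 0); rewrite /q0 /q1 /q2 /q3 [RHS]mxE.
Qed.

Lemma row_norm_lt (x : 'rV[R]_4) (e : R) : 0 < e ->
  (forall n, (n < 4)%N -> `|x ord0 (inord n)| < e) -> `|x| < e.
Proof.
move=> e0 hx; rewrite -[`|x|]/(mx_norm x) mx_normrE; apply/bigmax_ltP; split=> // -[i j] _ /=.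
by rewrite ord1 -(inord_val j) hx.
Qed.

Lemma sqr_norm_lt (x d e : R) : 0 < d -> x ^+ 2 <= 16 * d ^+ 2 -> 4 * d < e -> `|x| < e.
Proof.
move=> d0 xd de; have d4 : 0 <= 4 * d by rewrite mulr_ge0 // ltW.
suff x4 : `|x| <= 4 * d by exact: le_lt_trans x4 de.
rewrite -(ger0_norm d4) -ler_sqr ?nnegrE // !real_normK ?num_real //.
by apply: (le_trans xd); rewrite le_eqVlt; apply/orP; left; apply/eqP; ring.
Qed.

Lemma sqr_le_bounds (x d : R) : - d <= x -> x <= d -> x ^+ 2 <= d ^+ 2.
Proof.
move=> lx ux; have dx : 0 <= d - x by lra.
have dx' : 0 <= d + x by lra.
by have := mulr_ge0 dx dx'; lra.
Qed.

Lemma phi_inverse_continuous r h (e : R) : S3 h -> 0 < e ->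
  exists2 d : R, 0 < d & forall k, S3 k -> (forall S, `|phi r k S - phi r h S| < d) ->
    `|(k - h : 'rV[R]_4)| < e \/ `|(k + h : 'rV[R]_4)| < e.
Proof.
(* The coordinates of k - h or of k + h will be bounded by 4 d, so any d < e / 4 would do. *)
move=> hS e0; exists (e / 5); first by rewrite divr_gt0.
set d := e / 5; have d0 : 0 < d by rewrite divr_gt0.
have de : 4 * d < e by rewrite /d; lra.
move=> k kS close.
have {}close i j : (i < 3)%N -> (j < 3)%N -> - d < rot_entry k i j - rot_entry h i j < d.
  move=> lti ltj; have := close (mset (entry_mask i j)).
  rewrite -ltr_norml !phiE // -[form_of (three_list _ (rot_entry k))]/(phi_ext r k).
  by rewrite -[form_of (three_list _ (rot_entry h))]/(phi_ext r h) !phi_ext_coef.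
have hN : q0 h ^+ 2 + q1 h ^+ 2 + q2 h ^+ 2 + q3 h ^+ 2 = 1 := hS.
have kN : q0 k ^+ 2 + q1 k ^+ 2 + q2 k ^+ 2 + q3 k ^+ 2 = 1 := kS.
have := (close 0%N 0%N isT isT, close 0%N 1%N isT isT, close 0%N 2%N isT isT,
  close 1%N 0%N isT isT, close 1%N 1%N isT isT, close 1%N 2%N isT isT,
  close 2%N 0%N isT isT, close 2%N 1%N isT isT, close 2%N 2%N isT isT).
clear close; rewrite /rot_entry.
move: hN kN; rewrite /rot_entry.
set h0 := q0 h; set h1 := q1 h; set h2 := q2 h; set h3 := q3 h.
set k0 := q0 k; set k1 := q1 k; set k2 := q2 k; set k3 := q3 k => hN kN.
case=> [[[[[[[[/andP[l00 u00] /andP[l01 u01]] /andP[l02 u02]] /andP[l10 u10]] /andP[l11 u11]]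
  /andP[l12 u12]] /andP[l20 u20]] /andP[l21 u21]] /andP[l22 u22]].
have sq x := @sqr_le_bounds x d.
have p00 : (k0 * k0 - h0 * h0) ^+ 2 <= d ^+ 2 by apply: sq; lra.
have p11 : (k1 * k1 - h1 * h1) ^+ 2 <= d ^+ 2 by apply: sq; lra.
have p22 : (k2 * k2 - h2 * h2) ^+ 2 <= d ^+ 2 by apply: sq; lra.
have p33 : (k3 * k3 - h3 * h3) ^+ 2 <= d ^+ 2 by apply: sq; lra.
have p01 : (k0 * k1 - h0 * h1) ^+ 2 <= d ^+ 2 by apply: sq; lra.
have p02 : (k0 * k2 - h0 * h2) ^+ 2 <= d ^+ 2 by apply: sq; lra.
have p03 : (k0 * k3 - h0 * h3) ^+ 2 <= d ^+ 2 by apply: sq; lra.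
have p12 : (k1 * k2 - h1 * h2) ^+ 2 <= d ^+ 2 by apply: sq; lra.
have p13 : (k1 * k3 - h1 * h3) ^+ 2 <= d ^+ 2 by apply: sq; lra.
have p23 : (k2 * k3 - h2 * h3) ^+ 2 <= d ^+ 2 by apply: sq; lra.
(* 2 (1 - <h,k>^2) = |h h^T - k k^T|^2, and |k -+ h|^2 = 2 -+ 2 <h,k> *)
pose s := h0 * k0 + h1 * k1 + h2 * k2 + h3 * k3.
have s2 : 1 - s ^+ 2 <= 8 * d ^+ 2.
  have -> : 1 - s ^+ 2 = 2^-1 * ((k0 * k0 - h0 * h0) ^+ 2 + (k1 * k1 - h1 * h1) ^+ 2
      + (k2 * k2 - h2 * h2) ^+ 2 + (k3 * k3 - h3 * h3) ^+ 2
      + 2 * ((k0 * k1 - h0 * h1) ^+ 2 + (k0 * k2 - h0 * h2) ^+ 2 + (k0 * k3 - h0 * h3) ^+ 2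
        + (k1 * k2 - h1 * h2) ^+ 2 + (k1 * k3 - h1 * h3) ^+ 2 + (k2 * k3 - h2 * h3) ^+ 2)).
    have h0E : h0 ^+ 2 = 1 - h1 ^+ 2 - h2 ^+ 2 - h3 ^+ 2 by rewrite -hN; ring.
    have k0E : k0 ^+ 2 = 1 - k1 ^+ 2 - k2 ^+ 2 - k3 ^+ 2 by rewrite -kN; ring.
    by rewrite /s; field: h0E k0E.
  lra.
clear p00 p11 p22 p33 p01 p02 p03 p12 p13 p23
  l00 u00 l01 u01 l02 u02 l10 u10 l11 u11 l12 u12 l20 u20 l21 u21 l22 u22.
have foldq : (h ord0 (inord 0) = h0) * (h ord0 (inord 1) = h1) * (h ord0 (inord 2) = h2)
  * (h ord0 (inord 3) = h3) * (k ord0 (inord 0) = k0) * (k ord0 (inord 1) = k1)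
  * (k ord0 (inord 2) = k2) * (k ord0 (inord 3) = k3) by [].
have sqg (x : R) : 0 <= x ^+ 2 by exact: sqr_ge0.
have dm : (k0 - h0) ^+ 2 + (k1 - h1) ^+ 2 + (k2 - h2) ^+ 2 + (k3 - h3) ^+ 2 = 2 - 2 * s.
  by rewrite /s; lra.
have dp : (k0 + h0) ^+ 2 + (k1 + h1) ^+ 2 + (k2 + h2) ^+ 2 + (k3 + h3) ^+ 2 = 2 + 2 * s.
  by rewrite /s; lra.
have sm : 0 <= 1 - s.
  by have := sqg (k0 - h0); have := sqg (k1 - h1); have := sqg (k2 - h2); have := sqg (k3 - h3); lra.
have sp : 0 <= 1 + s.
  by have := sqg (k0 + h0); have := sqg (k1 + h1); have := sqg (k2 + h2); have := sqg (k3 + h3); lra.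
have [s0|s0] := leP 0 s; [left|right]; apply: row_norm_lt => // n ltn; apply: (sqr_norm_lt d0 _ de).
  (* As 0 <= s <= 1, 1 - s is at most 1 - s^2, which is at most 8 d^2. *)
  have b : 2 - 2 * s <= 16 * d ^+ 2 by have := mulr_ge0 s0 sm; lra.
  have := sqg (k0 - h0); have := sqg (k1 - h1); have := sqg (k2 - h2); have := sqg (k3 - h3).
  by case: n ltn => [|[|[|[|n]]]] // _; rewrite !mxE ?foldq; lra.
have b : 2 + 2 * s <= 16 * d ^+ 2.
  have ns0 : 0 <= - s by lra.
  by have := mulr_ge0 ns0 sp; lra.
have := sqg (k0 + h0); have := sqg (k1 + h1); have := sqg (k2 + h2); have := sqg (k3 + h3).
by case: n ltn => [|[|[|[|n]]]] // _; rewrite !mxE ?foldq; lra.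
Qed.

Lemma phi_eq r s h k : 0 < r -> 0 < s -> S3 h -> S3 k ->
  phi r h = phi s k <-> r = s /\ (k = h \/ k = - h).
Proof.
move=> r0 s0 hS kS; split=> [e|[-> kh]]; last first.
  rewrite !phiE //; congr form_of; case: kh => -> //.
  by apply: eq_three_list => i j _ _; rewrite rot_entry_opp.
have rs : r ^+ 3 = s ^+ 3.
  have := congr1 (fun f : extform R => f (mset (idx_mask [:: 1; 2; 3]%N))) e.
  rewrite (phiE r hS) (phiE s kS) !form_of_coef; [|by []|by []|by []|by []].
  by rewrite /three_list; lcbv; rewrite !addr0.
split.
  by apply/eqP; rewrite -(@eqrXn2 _ 3) ?ltW //; apply/eqP.
apply: rot_entry_inj => // i j lti ltj.
have := congr1 (fun f : extform R => f (mset (entry_mask i j))) e.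
rewrite (phiE r hS) (phiE s kS) -[form_of (three_list _ (rot_entry h))]/(phi_ext r h).
by rewrite -[form_of (three_list _ (rot_entry k))]/(phi_ext s k) !phi_ext_coef.
Qed.

Lemma RP3_embedding_phi r : 0 < r -> RP3_embedding (phi r).
Proof.
move=> r0; split=> [h k hS kS||h hS e e0].
- by rewrite phi_eq //; split=> [[]|].
- exists (phi_ext r); split; first exact: phi_ext_smooth.
    by move=> h hS; rewrite phiE.
  by move=> h v hS hv D; apply: phi_ext_immersion hS hv D.
exact: phi_inverse_continuous.
Qed.
End ProjectiveEmbedding.

Unset Implicit Arguments.

Local Open Scope classical_set_scope.
Local Open Scope ring_scope.

Theorem theorem2 (R : realType) :
  (forall r : R, 0 < r ->
     [/\ calB r = [set phi r h | h in @S3 R],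
         RP3_embedding (phi r),
         calB r = [set f | invariant_G2 f /\ metric f = g_ r] &
         forall f f' : extform R, calB r f -> invariant_G2 f' ->
           (isometric f f' <-> calB r f')])
  /\
  (forall (r s : R) (f f' : extform R), 0 < r -> 0 < s -> calB r f -> calB s f' ->
     (isometric f f' <-> r = s))
  /\
  (forall (r s : R) (h k : quat R), 0 < r -> 0 < s -> S3 h -> S3 k ->
     (phi r h = phi s k <-> r = s /\ (k = h \/ k = - h)))
  /\
  (forall (r : R) (h : quat R), 0 < r -> S3 h ->
     [/\ coclosed (phi r h) <-> equator h \/ poles h,
         nearly_parallel (phi r h) <->
           (r = 2 `^ 3^-1 /\ equator h) \/ (r = (2 / 5) `^ 3^-1 /\ poles h),
         loc_conf_coclosed (phi r h) <-> r = 1 \/ coclosed (phi r h) &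
         ~ purely_coclosed (phi r h)])
  /\
  round_metric (g_ ((2 : R) `^ 3^-1))
  /\
  squashed_metric (g_ ((2 / 5 : R) `^ 3^-1)).
Proof.
have sub r (f : extform R) : 0 < r -> calB r f <-> invariant_G2 f /\ metric f = g_ r.
  by move=> r0; rewrite invariant_G2_three // calB_three_form.
have c1 : 0 < (2 : R) `^ 3^-1 by rewrite powR_gt0.
have c2 : 0 < (2 / 5 : R) `^ 3^-1 by rewrite powR_gt0 // divr_gt0.
split; [|split; [|split; [|split; [|split]]]].
- move=> r r0; split.
  + by apply/seteqP; split=> f /=; rewrite calB_phi => -[h hS <-]; exists h.
  + exact: RP3_embedding_phi.
  + by apply/seteqP; split=> f /=; rewrite sub.
  + move=> f f' /(sub _ _ r0)[_ fg] f'G; rewrite /isometric fg sub //.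
    by split=> [->|[]].
- move=> r s f f' r0 s0 /(sub _ _ r0)[_ fg] /(sub _ _ s0)[_ f'g]; rewrite /isometric fg f'g.
  (* The last diagonal entry of g_r is 1/r, which determines r. *)
  split=> [/matrixP/(_ ord_max ord_max)|-> //]; rewrite !mxE eqxx /= !mulr1n.
  exact: invr_inj.
- by move=> r s h k r0 s0 hS kS; exact: phi_eq.
- move=> r h r0 hS; split.
  + by rewrite coclosed_phi // coclosed_eqsP.
  + exact: nearly_parallel_phi.
  + exact: loc_conf_coclosed_phi.
  + exact: not_purely_coclosed_phi.
- by apply: hopf_g => //; rewrite mulr1; apply/cube_root.
by apply: hopf_g; rewrite ?invr_gt0 //; apply/cube_root => //; rewrite divr_gt0.
Qed.
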